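(* Let $M$ be separable metrizable and $\kappa=|M|$. Then $$\mathbf{seq}(M)=_T P(\kappa)\times(\lambda_M,=)\;+\;Q(\kappa)\times(\mu_M,=)\;+\;S(\kappa),$$ where $\lambda_M=|M_\kappa^+|$ is $\le\kappa$ and $\mu_M=|M_\kappa^-|$ is in $\omega+1$ (i.e. $\mu_M\le\omega$).
   Context: A relation is a triple $\mathbf{A}=(A_-,A_+,A)$ of sets $A_-,A_+$ and a binary predicate $xAy$ for $x\in A_-$, $y\in A_+$; $(A',A)$ abbreviates $(A',A',A)$. A (Tukey) morphism from $\mathbf{A}$ to $\mathbf{B}$ is a pair $(\psi_-,\phi_+)$ of functions $\psi_-:B_-\to A_-$, $\phi_+:A_+\to B_+$ such that $\psi_-(b)\,A\,a$ implies $b\,B\,\phi_+(a)$ for all $b\in B_-$, $a\in A_+$. Write $\mathbf{A}\ge_T\mathbf{B}$ if there is such a morphism, and $\mathbf{A}=_T\mathbf{B}$ if $\mathbf{A}\ge_T\mathbf{B}$ and $\mathbf{B}\ge_T\mathbf{A}$. $\mathbf{A}\times\mathbf{B}=(A_-\times B_-,A_+\times B_+,A\times B)$, with the predicate coordinatewise. The sum $\sum_{i}\mathbf{A}_i$ (binary: $\mathbf{A}+\mathbf{B}$) has as first and second entries the disjoint unions of the $(A_i)_-$ and of the $(A_i)_+$, with $x$ related to $y$ iff for some $i$, $x\in(A_i)_-$, $y\in(A_i)_+$ and $xA_iy$. For a cardinal $\lambda$, $(\lambda,=)$ is equality on $\lambda$. $\mathbf{0}=(\emptyset,\emptyset,\emptyset)$.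 For a space $X$: $\mathrm{NC}(X)$ is the set of non-closed subsets of $X$; $\mathrm{CS}^+(X)=\{e(\omega+1): e \text{ an embedding of the space }\omega+1\text{ into }X\}$ (infinite convergent sequences with limit); $S\,(\neg c)\,T$ means $S\cap T$ is not closed in $T$; $\mathbf{seq}(X)=(\mathrm{NC}(X),\mathrm{CS}^+(X),\neg c)$. For a sequence of cardinals $(\kappa_n)_n$, $\left(\prod_n[\kappa_n]^{<\omega}\right)_\infty$ is the set of sequences $(F_n)_{n\in\omega}$, with $F_n$ a finite subset of $\kappa_n$, such that $F_n\neq\emptyset$ for infinitely many $n$; $(F_n)_n\,i_\infty\,(G_n)_n$ means $F_n\cap G_n\neq\emptyset$ for infinitely many $n$. $P(\kappa)=\left((([\kappa]^{<\omega})^\omega)_\infty,i_\infty\right)$ (the case where all $\kappa_n=\kappa$). If $\mathrm{cof}(\kappa)\neq\omega$ then $Q(\kappa)=S(\kappa)=\mathbf{0}$. Otherwise, select a sequence of cardinals $(\kappa_n)_n$ strictly increasing up to $\kappa$, and let $Q(\kappa)=\left(\left(\prod_n[\kappa_n]^{<\omega}\right)_\infty,i_\infty\right)$ and $S(\kappa)=\sum_n P(\kappa_n)\times(\kappa_n,=)$ (up to $=_T$ these do not depend on the choice of $(\kappa_n)_n$). For each $x\in M$ fix an open neighbourhood $U_x$ of $x$ of minimal cardinality, and let $M_\kappa=\{x\in M:|U_x|=\kappa\}$. $M_\kappa^+$ is the set of $x\in M_\kappa$ which have a neighbourhood base $(B_n)_n$ such that every $B_n\setminus B_{n+1}$ has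 cardinality $\kappa$; $M_\kappa^-=M_\kappa\setminus M_\kappa^+$.
   Formalization: S(κ) is taken to be 0 when κ=ω: literally S(ω) (with finite κ_n) is =_T (ω,=), and the claim then fails for M countable discrete, where seq(M)=0 but S(ω) has nonempty first entry; for all other κ, S(κ) is as defined. *)

(* Defs.v *)
(* Cardinals are represented, as in mathcomp.classical, by
   arbitrary sets compared with #<= and #=: a cardinal is a type K, standing
   for the cardinality of [set: K]. *)
From HB Require Import structures.
From mathcomp Require Import all_boot all_order all_algebra.
From mathcomp Require Import wochoice all_classical all_reals all_analysis.

Set Implicit Arguments.
Unset Strict Implicit.
Unset Printing Implicit Defensive.

Import Order.TTheory GRing.Theory Num.Theory.
Local Open Scope classical_set_scope.
Local Open Scope card_scope.
Local Open Scope ring_scope.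

(* ** Relations and Tukey morphisms *)

Record trel := TRel {
  tneg : Type;
  tpos : Type;
  trelP : tneg -> tpos -> Prop
}.

Definition tukey_morphism (A B : trel)
    (psi : tneg B -> tneg A) (phi : tpos A -> tpos B) : Prop :=
  forall b a, @trelP A (psi b) a -> @trelP B b (phi a).

Definition tukey_ge (A B : trel) : Prop :=
  exists psi phi, @tukey_morphism A B psi phi.

Definition tukey_eq (A B : trel) : Prop := tukey_ge A B /\ tukey_ge B A.

Definition tzero : trel := @TRel void void (fun _ _ => False).

Definition teq (L : Type) : trel := @TRel L L (fun x y => x = y).

Definition tprod (A B : trel) : trel :=
  @TRel (tneg A * tneg B) (tpos A * tpos B)
    (fun x y => @trelP A x.1 y.1 /\ @trelP B x.2 y.2).

Definition tsum (I : Type) (A : I -> trel) : trel :=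
  @TRel {i : I & tneg (A i)} {i : I & tpos (A i)}
    (fun x y => exists i (a : tneg (A i)) (b : tpos (A i)),
       [/\ x = existT _ i a, y = existT _ i b & trelP a b]).

Definition tadd (A B : trel) : trel :=
  @TRel (tneg A + tneg B) (tpos A + tpos B)
    (fun x y => match x, y with
                | inl a, inl a' => trelP a a'
                | inr b, inr b' => trelP b b'
                | _, _ => False
                end).

(* ** Cardinals *)

Definition card_lt T U (A : set T) (B : set U) : Prop :=
  A #<= B /\ ~ (B #<= A).

(* [r] orders K as the initial ordinal of cardinality |K|. *)
Definition initial_order (K : Type) (r : rel K) : Prop :=
  [/\ total_order r, well_order r
    & forall x, card_lt [set y | r y x /\ y <> x] [set: K]].

Definition cofinal (K : Type) (r : rel K) (C : set K) : Prop :=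
  forall x, exists2 y, C y & r x y.

(* cof(K) = omega: the least cardinality of a cofinal subset of the initial
   ordinal of cardinality |K| is omega. *)
Definition cof_omega (K : Type) : Prop :=
  exists2 r : rel K, initial_order r &
    (exists2 C, cofinal r C & C #= [set: nat]) /\
    (forall C, cofinal r C -> [set: nat] #<= C).

(* The cardinals Kn n strictly increase and their supremum is K; every
   cardinal that could be a smaller upper bound is that of some A : set K. *)
Definition increasing_up_to (Kn : nat -> Type) (K : Type) : Prop :=
  [/\ forall n, card_lt [set: Kn n] [set: Kn n.+1],
      forall n, [set: Kn n] #<= [set: K]
    & forall A : set K, (forall n, [set: Kn n] #<= A) -> [set: K] #<= A].

(* ** The relations P, Q and S *)

Definition fin_seq_infty (Kn : nat -> Type) : Type :=
  {F : forall n, set (Kn n) |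
    (forall n, finite_set (F n)) /\ infinite_set [set n | F n !=set0]}.

Definition i_infty (Kn : nat -> Type) (F G : fin_seq_infty Kn) : Prop :=
  infinite_set [set n | sval F n `&` sval G n !=set0].

Definition prod_infty (Kn : nat -> Type) : trel := TRel (@i_infty Kn).

Definition relP (K : Type) : trel := prod_infty (fun=> K).

(* In relQ and relS, Kn is meant to satisfy [increasing_up_to Kn K] when
   cof(K) = omega; it is irrelevant otherwise. *)
Definition relQ (K : Type) (Kn : nat -> Type) : trel :=
  if `[< cof_omega K >] then prod_infty Kn else tzero.

(* For K = omega the Kn n are finite, and the sum below would be Tukey
   equivalent to (omega, =) although the points it accounts for, those with a
   neighbourhood of cardinality < omega, are isolated and contribute nothing:
   for M countable discrete, seq(M) is 0. Hence relS is 0 for K = omega. *)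
Definition relS (K : Type) (Kn : nat -> Type) : trel :=
  if `[< cof_omega K /\ ~ countable [set: K] >]
  then tsum (fun n => tprod (relP (Kn n)) (teq (Kn n)))
  else tzero.

(* ** Spaces *)

Definition metrizable (R : realType) (X : topologicalType) : Prop :=
  exists d : X -> X -> R,
    [/\ forall x y, 0 <= d x y,
        forall x y, d x y = 0 <-> x = y,
        forall x y, d x y = d y x,
        forall x y z, d x z <= d x y + d y z
      & forall x (V : set X),
          nbhs x V <-> exists2 e : R, 0 < e & [set y | d x y < e] `<=` V].

Definition separable (X : topologicalType) : Prop :=
  exists2 D : set X, countable D & dense D.

Definition embedding (X Y : topologicalType) (e : X -> Y) : Prop :=
  injective e /\
  forall A : set X, open A <-> exists2 B : set Y, open B & A = e @^-1` B.

(* The space omega + 1, the limit point omega being [None]. *)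
Definition omega_succ : topologicalType := one_point_compactification nat.

Definition NC (X : topologicalType) : Type := {S : set X | ~ closed S}.

Definition CSplus (X : topologicalType) : Type :=
  {T : set X | exists2 e : omega_succ -> X, embedding e & T = range e}.

Definition not_closed_in (X : topologicalType) (S T : set X) : Prop :=
  ~ closed (S `&` T : set (subspace T)).

Definition seq_rel (X : topologicalType) : trel :=
  @TRel (NC X) (CSplus X) (fun S T => not_closed_in (sval S) (sval T)).

Definition min_card_open_nbhs (X : topologicalType) (U : X -> set X) : Prop :=
  forall x, open_nbhs x (U x) /\ forall V, open_nbhs x V -> U x #<= V.

Definition nbhs_base (X : topologicalType) (x : X) (B : nat -> set X) : Prop :=
  (forall n, nbhs x (B n)) /\
  (forall V, nbhs x V -> exists n, B n `<=` V).

Definition M_card (X : topologicalType) (U : X -> set X) (K : Type) : set X :=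
  [set x | U x #= [set: K]].

Definition M_card_plus (X : topologicalType) (U : X -> set X) (K : Type) :
    set X :=
  [set x | M_card U K x /\
    exists2 B : nat -> set X, nbhs_base x B &
      forall n, B n `\` B n.+1 #= [set: K]].

Definition M_card_minus (X : topologicalType) (U : X -> set X) (K : Type) :
    set X :=
  M_card U K `\` M_card_plus U K.

(* Main.v *)
Require Import Defs.
From HB Require Import structures.
From mathcomp Require Import all_boot all_order all_algebra.
From mathcomp Require Import wochoice all_classical all_reals all_analysis.
From mathcomp Require Import lra.

(** A non-closed set [S] is detected by convergent sequences at any point [x]
    of its closure that it misses, and [S] may be thinned to a sequence that
    converges to [x], which is then detected at [x] only.  Hence [seq(M)] is
    the sum, over the accumulation points [x] of [M], of the local relations
    [seq_at x] between sets that accumulate at [x] and sequences that converge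
    to [x] ([seq_rel_tsum]).

    Cut a neighbourhood of [x] into annuli.  A sequence converging to [x] meets
    each annulus in a finite set and infinitely many annuli, and conversely.
    So [seq_at x] only depends on how large annuli around [x] can be made:
    [prod_infty_ge_seq_at_level] bounds it from above by a product whose factors
    are at least as large as the annuli, and [seq_at_ge_prod_infty_annulus] from
    below by a product whose factors fit into suitably chosen annuli.  A ball is
    the union of its centre and countably many annuli, so for every cardinal
    less than that of the ball some annulus is at least as large
    ([annulus_large]).  This gives [P(kappa)] at the points of [M_kappa^+],
    [Q(kappa)] at those of [M_kappa^-] when [kappa] has cofinality [omega], and
    then a relation below [P(kappa_n)] for large [n] at each point with a
    neighbourhood of size less than [kappa].

    What remains is to match summands injectively in both directions
    ([tsum_eq]).  A countable base shows that the points [x] with [|U_x| <= L]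
    are covered by countably many sets of size at most [L] ([low_le]), and that
    [M_kappa^-], a discrete subspace, is countable.  If [kappa] is infinite and
    does not have cofinality [omega], a set of size [kappa] is not a countable
    union of smaller sets ([cof_omega_bigcup]); then [M_kappa^-] is empty and
    [M_kappa^+] has size [kappa], so it absorbs all other points.  If [kappa] is
    uncountable of cofinality [omega], then [M_kappa^+] or the set of points with
    small neighbourhoods has size [kappa], and either one has room for all the
    summands of [S(kappa)] ([relS_points]). *)

Set Implicit Arguments.
Unset Strict Implicit.
Unset Printing Implicit Defensive.

Import Order.TTheory GRing.Theory Num.Theory.
Local Open Scope classical_set_scope.
Local Open Scope card_scope.

(** * Cardinal comparison and countable unions *)

Lemma card_le_fun T U (A : set T) (B : set U) (f : T -> U) :
  (forall x, A x -> B (f x)) ->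
  (forall x y, A x -> A y -> f x = f y -> x = y) -> A #<= B.
Proof.
move=> AB fI; have fI' : {in A &, injective f}.
  by move=> x y /set_mem Ax /set_mem Ay; exact: fI.
rewrite -(card_le_eql (inj_card_eq fI')); apply: subset_card_le.
by move=> _ [x Ax <-]; exact: AB.
Qed.

(** The codomain has to be nonempty for a function on all of [T] to exist. *)
Lemma card_le_funP T U (A : set T) (B : set U) : B !=set0 -> A #<= B ->
  exists f : T -> U, (forall x, A x -> B (f x)) /\
    (forall x y, A x -> A y -> f x = f y -> x = y).
Proof.
move=> [b Bb] /card_leP[f].
pose g x := if pselect (A x) is left Ax then val (f (SigSub (mem_set Ax))) else b.
have gE x (Ax : A x) : g x = val (f (SigSub (mem_set Ax))).
  rewrite /g; case: pselect => // Ax'.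
  by congr (val (f _)); exact: val_inj.
exists g; split=> [x Ax|x y Ax Ay].
  by rewrite gE; exact: set_valP.
rewrite !gE => /val_inj /(@inj _ _ _ f); rewrite !inE => /(_ I I).
by move=> /(congr1 val).
Qed.

(** Injective relations, unlike functions, need no default value outside [A],
    which makes this form usable when [U] may be empty. *)
Lemma card_le_relP T U (A : set T) (B : set U) :
  A #<= B <-> exists R : T -> U -> Prop,
    (forall x, A x -> exists2 y, B y & R x y) /\
    (forall x x' y, A x -> A x' -> R x y -> R x' y -> x = x').
Proof.
split=> [|[R [Rt Ri]]].
  have [->|/set0P B0] := eqVneq B set0.
    rewrite card_le0 => /eqP ->; exists (fun _ _ => False).
    by split.
  move=> /(card_le_funP B0)[f [fB fI]]; exists (fun x y => f x = y); split.
    by move=> x Ax; exists (f x) => //; exact: fB.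
  by move=> x x' y Ax Ax' <- /esym; exact: fI.
have [->|/set0P [a Aa]] := eqVneq A set0; first exact: card_ge0.
have [b Bb _] := Rt _ Aa.
have /choice[f fP] x : exists y, A x -> B y /\ R x y.
  have [/Rt[y By Rxy]|] := pselect (A x); first by exists y.
  by move=> ?; exists b.
apply: (@card_le_fun _ _ _ _ f) => [x /fP[]//|x x' Ax Ax' e].
by apply: (Ri _ _ (f x)) => //; [apply (fP x)|rewrite e; apply (fP x')].
Qed.

Lemma card_leT_funP T U (B : set U) : [set: T] #<= B ->
  exists f : T -> U, (forall x, B (f x)) /\ injective f.
Proof.
move=> /card_le_relP[R [Rt Ri]].
have /choice[f fP] x : exists y, B y /\ R x y by have [y] := Rt x I; exists y.
exists f; split=> [x|x y fxy]; first exact: (fP x).1.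
by apply: (Ri _ _ (f x)) => //; [exact: (fP x).2|rewrite fxy; exact: (fP y).2].
Qed.

(** The maximal partial injection given by Zorn's lemma is total or onto. *)
Lemma card_le_total T U (A : set T) (B : set U) : A #<= B \/ B #<= A.
Proof.
pose P (G : set (T * U)) := (forall p, G p -> A p.1 /\ B p.2) /\
  (forall p q, G p -> G q -> p.1 = q.1 \/ p.2 = q.2 -> p = q).
have [F FP Ftot|G [[GAB Ginj] Gmax]] := @Zorn_bigcup _ P.
  split=> [p [G /FP[GP _] Gp]|p q [G FG Gp] [H FH Hq]]; first exact: GP.
  have [GH|HG] := Ftot _ _ FG FH.
    by apply: (FP _ FH).2 => //; exact: GH.
  by apply: (FP _ FG).2 => //; exact: HG.
have [GA|nGA] := pselect (forall a, A a -> exists b, G (a, b)).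
  left; apply/card_le_relP; exists (fun a b => G (a, b)); split.
    by move=> a /GA[b Gab]; exists b => //; exact: (GAB _ Gab).2.
  by move=> a a' b _ _ G1 G2; case: (Ginj _ _ G1 G2 (or_intror erefl)).
right; apply/card_le_relP; exists (fun b a => G (a, b)); split; last first.
  by move=> a a' b _ _ G1 G2; case: (Ginj _ _ G1 G2 (or_introl erefl)).
move=> b Bb; apply: contrapT => nb; apply: nGA => a Aa; apply: contrapT => na.
apply: (Gmax (G `|` [set (a, b)])).
  split; first exact: subsetUl.
  by move=> /(_ (a, b)) H; apply: na; exists b; apply: H; right.
split=> [p [/GAB//|->//]|p q [Gp|->] [Gq|->]//=]; first exact: Ginj.
  case=> [e|e]; case: p Gp e => a' b' /= Gp e; subst.
    by case: na; exists b'.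
  by case: nb; exists a' => //; exact: (GAB _ Gp).1.
case=> [e|e]; case: q Gq e => a' b' /= Gp e; subst.
  by case: na; exists b'.
by case: nb; exists a' => //; exact: (GAB _ Gp).1.
Qed.

Lemma card_nle T U (A : set T) (B : set U) : ~ (B #<= A) -> A #<= B.
Proof. by case: (card_le_total A B). Qed.

(** A maximal family of disjoint countably infinite sets covers all but
    finitely many points.  Each member [C] absorbs the product [C * nat], and
    one of them has room for the remaining points as well. *)
Lemma card_le_setX_nat T :
  infinite_set [set: T] -> [set: T * nat] #<= [set: T].
Proof.
move=> Tinf.
pose P (F : set (set T)) := (forall C, F C -> C #= [set: nat]) /\
  (forall C D, F C -> F D -> C `&` D !=set0 -> C = D).
have [G GP Gtot|F [[Fnat Fdisj] Fmax]] := @Zorn_bigcup _ P.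
  split=> [C [F /GP[FP _] FC]|C D [F GF FC] [H GH HD]]; first exact: FP.
  have [FH|HF] := Gtot _ _ GF GH.
    by apply: (GP _ GH).2 => //; exact: FH.
  by apply: (GP _ GF).2 => //; exact: HF.
pose rest := ~` \bigcup_(C in F) C.
have rest_fin : finite_set rest.
  apply: contrapT => rest_inf; have := rest_inf.
  move=> /infiniteP /(card_le_funP (infinite_setN0 rest_inf))[f [fr fI]].
  have fIn : {in [set: nat] &, injective f} by move=> x y _ _; exact: fI.
  have fF C : F C -> ~ (C `&` range f !=set0).
    by move=> FC [t [Ct [n _ fnE]]]; apply: (fr n I); exists C => //=; rewrite fnE.
  apply: (Fmax (F `|` [set range f])).
    split; first exact: subsetUl.
    move=> /(_ (range f) (or_intror erefl)) Ff; apply: (fF _ Ff).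
    by exists (f 0%N); split; exists 0%N.
  split=> [C [/Fnat//|->]|C D [FC|->] [FD|->]//]; first exact: inj_card_eq.
  - exact: Fdisj.
  - by move=> /(fF _ FC).
  - by rewrite setIC => /(fF _ FD).
have [C0 FC0] : F !=set0.
  apply/set0P/eqP => F0; apply: Tinf; apply: sub_finite_set rest_fin.
  by move=> t _ [C]; rewrite F0.
have /choice[e eP] C : exists e : nat -> T, F C ->
    (forall n, C (e n)) /\ injective e.
  have [t0 _] := infinite_setN0 Tinf.
  have [FC|nFC] := pselect (F C); last by exists (fun=> t0).
  have := Fnat _ FC; rewrite card_eq_sym => /card_eqPle[+ _].
  have [t Ct] : C !=set0.
    apply/set0P/eqP => CE; have := Fnat _ FC; rewrite CE card_eq_sym card_eq0.
    by move=> /eqP nat0; have : [set: nat] 0%N by []; rewrite nat0.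
  move=> /(card_le_funP (ex_intro _ t Ct))[e [eC eI]]; exists e => _.
  by split=> [n|m n]; [exact: eC|exact: eI].
have /choice[i iP] C : exists i : T -> nat, F C ->
    forall s t, C s -> C t -> i s = i t -> s = t.
  have [FC|nFC] := pselect (F C); last by exists (fun=> 0%N).
  have := Fnat _ FC; move=> /card_eqPle[/(card_le_funP (ex_intro _ 0%N I))[i [_ iI]] _].
  by exists i.
have := countableX (finite_set_countable rest_fin) (countableP [set: nat]).
move=> /(card_le_funP (ex_intro _ 0%N I))[g [_ gI]].
apply/card_le_relP.
(* Odd positions of the members receive their own products, and even positions
   of [C0] the product of the remaining points. *)
exists (fun p y => (exists C, [/\ F C, C p.1 & y = e C (pickle (i C p.1, p.2)).*2.+1])
  \/ rest p.1 /\ y = e C0 (g p).*2); split.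
  move=> [t n] _; have [[C FC Ct]|rt] := pselect ((\bigcup_(C in F) C) t); last first.
    by exists (e C0 (g (t, n)).*2) => //; right.
  by exists (e C (pickle (i C t, n)).*2.+1) => //; left; exists C.
have eFI C D m n : F C -> F D -> e C m = e D n -> C = D /\ m = n.
  move=> FC FD emn; suff CD : C = D.
    by subst D; split => //; have [_ eI] := eP _ FC; exact: eI.
  apply: Fdisj => //; exists (e C m); split; first by have [] := eP _ FC.
  by rewrite emn; have [] := eP _ FD.
move=> [t n] [s m] y _ _ [[C [FC /= Ct ->]]|[rt ->]].
  move=> [[D [FD /= Ds /(eFI _ _ _ _ FC FD)[CD]]]|[rs /(eFI _ _ _ _ FC FC0)[_]]].
    subst D; move=> /eqP; rewrite eqSS (inj_eq double_inj) => /eqP.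
    by move=> /(pcan_inj pickleK)[/(iP _ FC _ _ Ct Ds) -> ->].
  by move=> /(congr1 odd) /=; rewrite !odd_double.
move=> [[D [FD /= Ds /(eFI _ _ _ _ FC0 FD)[_]]]|[rs /(eFI _ _ _ _ FC0 FC0)[_]]].
  by move=> /(congr1 odd) /=; rewrite !odd_double.
by move=> /double_inj; exact: gI.
Qed.

Lemma card_le_bigcup_nat T (V : nat -> set T) L :
  (forall m, V m #<= [set: L]) -> \bigcup_m V m #<= [set: L * nat].
Proof.
move=> VL; have /choice[R RP] m := (card_le_relP (V m) [set: L]).1 (VL m).
apply/card_le_relP; exists (fun x p => V p.2 x /\ R p.2 x p.1); split.
  by move=> x [m _ Vx]; have [l _ Rxl] := (RP m).1 _ Vx; exists (l, m).
by move=> x x' [l m] _ _ /= [Vx Rx] [Vx' Rx']; exact: ((RP m).2 _ _ l).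
Qed.

Lemma infinite_bigcup_nat_le T (V : nat -> set T) L :
  infinite_set [set: L] -> (forall m, V m #<= [set: L]) ->
  \bigcup_m V m #<= [set: L].
Proof.
move=> /card_le_setX_nat Linf /card_le_bigcup_nat VL.
exact: card_le_trans VL Linf.
Qed.

(** For finite [L] the union is merely countable, hence the hypothesis on [K]. *)
Lemma uncountable_bigcup_nat_le T (V : nat -> set T) K L :
  ~ countable [set: K] -> (forall m, V m #<= [set: L]) ->
  [set: K] #<= \bigcup_m V m -> [set: K] #<= [set: L].
Proof.
move=> Kunc VL KV.
have [Lfin|Linf] := pselect (finite_set [set: L]); last first.
  exact: card_le_trans KV (infinite_bigcup_nat_le Linf VL).
case: Kunc; apply: card_le_trans KV _; apply: bigcup_countable => // m _.
exact: sub_countable (VL m) (finite_set_countable Lfin).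
Qed.

Lemma infinite_setU_le T L (A B : set T) :
  infinite_set [set: L] -> A #<= [set: L] -> B #<= [set: L] ->
  A `|` B #<= [set: L].
Proof.
move=> Linf AL BL.
have -> : A `|` B = \bigcup_m (if m == 0%N then A else B).
  apply/seteqP; split=> [x [Ax|Bx]|x [[|m] _ //= ?]]; [| |by left|by right].
    by exists 0%N.
  by exists 1%N.
by apply: infinite_bigcup_nat_le => // -[|m].
Qed.

Lemma infinite_le_setU T K (A B : set T) : infinite_set [set: K] ->
  [set: K] #<= A `|` B -> [set: K] #<= A \/ [set: K] #<= B.
Proof.
wlog AB : A B / A #<= B => [th|] Kinf KAB.
  have [AB|BA] := card_le_total A B; first exact: th.
  by rewrite setUC in KAB; have [] := th _ _ BA Kinf KAB; [right|left].
right; apply: card_le_trans (KAB) _.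
have Binf : infinite_set B.
  move=> Bfin; apply: Kinf; apply: card_le_finite KAB _.
  by rewrite finite_setU; split => //; exact: card_le_finite AB Bfin.
rewrite -(card_le_eqr (card_setT B)); apply: infinite_setU_le.
- by rewrite (eq_finite_set (card_setT B)).
- by rewrite (card_le_eqr (card_setT B)).
- by rewrite (card_le_eqr (card_setT B)).
Qed.

Lemma finite_nat_bound (A : set nat) :
  finite_set A -> exists N, forall n, A n -> (n <= N)%N.
Proof.
move=> /finite_seqP[s ->]; exists (\max_(n <- s) n)%N => n /= ns.
exact: (leq_bigmax_seq _ ns).
Qed.

Lemma infinite_nat_unbounded (A : set nat) :
  (forall N, exists2 n, (N <= n)%N & A n) -> infinite_set A.
Proof.
move=> Aub /finite_nat_bound[N AN].
by have [n Nn /AN] := Aub N.+1; rewrite leqNgt Nn.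
Qed.

Section well_order.
Variables (T : eqType) (W : rel T) (Wwo : well_order W).

(** Transitivity comes from the minimum of the three points involved. *)
Lemma well_order_total : total_order W.
Proof.
have Wc : wo_chain W predT by move=> A _; exact: Wwo.
have Wrefl : reflexive W by move=> x; exact: (wo_chain_reflexive Wc).
have Wanti : antisymmetric W by move=> x y; exact: (wo_chain_antisymmetric Wc).
split; last by move=> x y; exact: (wo_chainW Wc).
split=> //; split=> // y x z xy yz.
have [|w [[wA wmin] _]] := @Wwo [pred t | t \in [:: x; y; z]].
  by exists x; rewrite !inE eqxx.
have [wx wy wz] : [/\ W w x, W w y & W w z].
  by split; apply: wmin; rewrite !inE eqxx ?orbT.
move: wA; rewrite !inE => /or3P[] /eqP we; subst w => //.
  by have -> : x = y by apply: Wanti; rewrite xy.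
by have <- : y = z by apply: Wanti; rewrite yz.
Qed.

End well_order.

(** Ordering the points by the least index of a piece that contains them, and
    the points with the same index by any well-order, gives a well-order whose
    initial segments lie in finitely many pieces and are therefore small.  It
    is thus an initial order, and one point for each index is cofinal. *)
Lemma cof_omega_bigcup (K : Type) (V : nat -> set K) :
  infinite_set [set: K] -> (forall m, ~ ([set: K] #<= V m)) ->
  (forall x, exists m, V m x) -> cof_omega K.
Proof.
elim/Peq : K V => K V Kinf Vsmall Vcover.
have [W Wwo] := well_ordering_principle K.
have [[[Wrefl Wtrans] Wanti] Wtot] := well_order_total Wwo.
have exV x : exists m, `[< V m x >] by have [m Vm] := Vcover x; exists m; apply/asboolP.
pose f x := ex_minn (exV x).
have Vf x : V (f x) x by rewrite /f; case: ex_minnP => m /asboolP.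
pose below N := [set x | (f x <= N)%N].
have below_small N : ~ ([set: K] #<= below N).
  elim: N => [|N IH] KN.
    apply: (Vsmall 0%N); apply: card_le_trans KN (subset_card_le _) => x.
    by rewrite /below /= leqn0 => /eqP <-.
  have [//|] : [set: K] #<= below N \/ [set: K] #<= V N.+1; last exact: Vsmall.
  apply: infinite_le_setU => //; apply: card_le_trans KN (subset_card_le _) => x.
  by rewrite /below /= leq_eqVlt => /orP[/eqP <-|]; [right|left].
have above N : exists x, (N < f x)%N.
  apply: contrapT => nx; apply: (below_small N); apply: subset_card_le => x _.
  by rewrite /below /= leqNgt; apply/negP => fx; apply: nx; exists x.
pose r x y := (f x < f y)%N || (f x == f y) && W x y.
have rtot : total_order r.
  split; last first.
    move=> x y; rewrite /r; case: ltngtP => //= _; exact: Wtot.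
  split; last first.
    move=> x y; rewrite /r; case: ltngtP => //= _; exact: Wanti.
  split=> [x|y x z]; first by rewrite /r ltnn eqxx Wrefl.
  rewrite /r => /orP[xy|/andP[/eqP -> xy]] /orP[yz|/andP[/eqP <- yz]].
  - by rewrite (ltn_trans xy yz).
  - by rewrite xy.
  - by rewrite yz.
  - by rewrite eqxx (Wtrans _ _ _ xy yz) orbT.
have rwo : well_order r.
  apply: antisymmetric_well_order; first by have [[]] := rtot.
  move=> A [a aA].
  have exn : exists n, `[< exists2 x, x \in A & f x = n >].
    by exists (f a); apply/asboolP; exists a.
  case: (ex_minnP exn) => n /asboolP[b bA fb] nmin.
  have [|z [[zA zmin] _]] := @Wwo [pred x | (x \in A) && (f x == n)].
    by exists b; rewrite inE bA fb /=.
  move: zA; rewrite inE => /andP[zA /eqP fz]; exists z; split => // x xA.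
  rewrite /r fz; have := nmin (f x); case: ltngtP => //= [xn|xn].
    by move=> /(_ _)/negP[]//; apply/asboolP; exists x.
  by move=> _; apply: zmin; rewrite inE xA xn /=.
exists r; first split => // x.
  have sub : [set y | r y x /\ y <> x] `<=` below (f x).
    by move=> y [+ _]; rewrite /r /below /= => /orP[/ltnW//|/andP[/eqP ->]].
  split; first exact: card_leT.
  by move=> /card_le_trans /(_ (subset_card_le sub)); exact: below_small.
have cofinf C : cofinal r C -> [set: nat] #<= C.
  move=> Ccof; apply/infiniteP => /(finite_image f) /finite_nat_bound[N CN].
  have [x Nx] := above N; have [y Cy] := Ccof x.
  have : (f y <= N)%N by apply: CN; exists y.
  move=> yN; have yx := leq_ltn_trans yN Nx.
  by rewrite /r ltnNge (ltnW yx) /= => /andP[/eqP e]; rewrite e ltnn in yx.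
split=> //.
have /choice[c cP] n : exists x, (exists y, f y = n) -> f x = n.
  have [[y fy]|n0] := pselect (exists y, f y = n); first by exists y.
  by have [x _] := above 0; exists x.
have ccof : cofinal r (range c).
  move=> x; have [y xy] := above (f x); exists (c (f y)); first by exists (f y).
  by rewrite /r cP ?xy //; exists y.
exists (range c) => //; apply/card_eqPle; split; last exact: cofinf.
exact: card_image_le.
Qed.

(** * Sums of relations in the Tukey order *)

Lemma tukey_ge_trans A B C : tukey_ge A B -> tukey_ge B C -> tukey_ge A C.
Proof.
move=> [psi [phi m]] [psi' [phi' m']].
by exists (psi \o psi'), (phi' \o phi) => b a /m /m'.
Qed.

Lemma tukey_eq_sym A B : tukey_eq A B -> tukey_eq B A.
Proof. by case. Qed.

Lemma tukey_eq_trans A B C : tukey_eq A B -> tukey_eq B C -> tukey_eq A C.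
Proof. by move=> [? ?] [? ?]; split; apply: tukey_ge_trans; eassumption. Qed.

Lemma tukey_ge_choice A B (psi : tneg B -> tneg A) :
  (forall a, exists b', forall b, trelP (psi b) a -> trelP b b') ->
  tukey_ge A B.
Proof. by move=> /choice[phi H]; exists psi, phi => b a; exact: H. Qed.

(** Elements that dominate nothing may be sent to any default value. *)
Lemma tukey_ge_default A B (psi : tneg B -> tneg A) : inhabited (tpos B) ->
  (forall a b0, trelP (psi b0) a ->
    exists b', forall b, trelP (psi b) a -> trelP b b') ->
  tukey_ge A B.
Proof.
move=> [b'] H; apply: (@tukey_ge_choice _ _ psi) => a.
have [[b0 ab0]|na] := pselect (exists b0, trelP (psi b0) a); first exact: H ab0.
by exists b' => b ab; case: na; exists b.
Qed.

(** Streicher's principle, which classical logic provides on every index type,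
    lets the summand of an element of a sum be compared without a cast. *)
Lemma existT_injr (T : Type) (P : T -> Type) (x : T) (a b : P x) :
  existT P x a = existT P x b -> a = b.
Proof. by elim/Peq : T => T in P x a b *; exact: existT_inj2. Qed.

Lemma tsum_relE I (A : I -> trel) i (a : tneg (A i)) (b : tpos (A i)) :
  @trelP (tsum A) (existT _ i a) (existT _ i b) <-> trelP a b.
Proof.
split=> [[j [c [d [ea eb cd]]]]|ab]; last by exists i, a, b.
have ij := existT_inj1 ea; subst j.
by rewrite (existT_injr ea) (existT_injr eb).
Qed.

Lemma tsum_rel_index I (A : I -> trel) x y : @trelP (tsum A) x y ->
  projT1 x = projT1 y.
Proof. by move=> [i [a [b [-> -> _]]]]. Qed.

(** An element of a summand outside the image of [f] is above nothing that [f]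
    produces, so any default value serves for it; the last hypothesis supplies
    one. *)
Lemma tsum_ge I J (A : I -> trel) (B : J -> trel) (f : J -> I) :
  injective f -> (forall j, tukey_ge (A (f j)) (B j)) ->
  (tpos (tsum A) -> inhabited (tpos (tsum B))) ->
  tukey_ge (tsum A) (tsum B).
Proof.
move=> fI AB inh; pose psi j := sval (cid (AB j)).
have AB1 j : exists phi, tukey_morphism (psi j) phi := svalP (cid (AB j)).
pose phi j := sval (cid (AB1 j)).
have m j : tukey_morphism (psi j) (phi j) := svalP (cid (AB1 j)).
apply: (@tukey_ge_choice (tsum A) (tsum B)
  (fun x => existT (fun i => tneg (A i)) (f (projT1 x)) (psi _ (projT2 x)))) => -[i a].
have [[j fj]|nfi] := pselect (exists j, f j = i).
  subst i; exists (existT _ j (phi j a)) => -[j' b] /= r.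
  have /fI jj' := tsum_rel_index r; simpl in jj'; subst j'.
  by apply/tsum_relE; apply: m; apply/tsum_relE.
have [b'] := inh (existT _ i a); exists b' => -[j b] /= /tsum_rel_index /= e.
by case: nfi; exists j.
Qed.

(** Inhabited summands provide the default values that [tsum_ge] asks for, in
    each direction through the other injection. *)
Lemma tsum_eq I J (A : I -> trel) (B : J -> trel) (f : J -> I) (g : I -> J) :
  injective f -> (forall j, tukey_ge (A (f j)) (B j)) ->
  injective g -> (forall i, tukey_ge (B (g i)) (A i)) ->
  (forall i, inhabited (tpos (A i))) -> (forall j, inhabited (tpos (B j))) ->
  tukey_eq (tsum A) (tsum B).
Proof.
move=> fI fAB gI gBA Ai Bi; split.
  apply: (tsum_ge fI fAB) => -[i _]; have [b] := Bi (g i).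
  by constructor; exact: (existT _ (g i) b).
apply: (tsum_ge gI gBA) => -[j _]; have [a] := Ai (f j).
by constructor; exact: (existT _ (f j) a).
Qed.

Lemma tzero_tsum (F : void -> trel) : tukey_eq tzero (tsum F).
Proof.
have n : {i : void & tneg (F i)} -> void by case.
have p : {i : void & tpos (F i)} -> void by case.
split.
  by exists n, (of_void _) => -[].
by exists (of_void _), p => -[].
Qed.

Lemma tprod_teq_tsum A L : tukey_eq (tprod A (teq L)) (tsum (fun _ : L => A)).
Proof.
split.
  exists (fun x => (projT2 x, projT1 x)), (fun y => existT (fun _ : L => tpos A) y.2 y.1).
  by move=> [l a] [b l'] /= [ab e]; subst l'; exists l, a, b.
exists (fun x => existT (fun _ : L => tneg A) x.2 x.1), (fun y => (projT2 y, projT1 y)).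
move=> [a l] [l' b] r; have e := tsum_rel_index r; simpl in e; subst l'.
by split => //; move/tsum_relE : r.
Qed.

Lemma tadd_empty A B : (tneg B -> False) -> (tpos B -> False) ->
  tukey_eq (tadd A B) A.
Proof.
move=> nB pB; split.
  exists inl, (fun y => match y with inl a => a | inr b => match pB b with end end).
  by move=> a [c|b] //; case: (pB b).
exists (fun x => match x with inl a => a | inr b => match nB b with end end), inl.
by move=> [a|b] c //; case: (nB b).
Qed.

Definition sum_family I J (F : I -> trel) (G : J -> trel) (x : I + J) : trel :=
  match x with inl i => F i | inr j => G j end.

Lemma tadd_ge A A' B B' : tukey_ge A A' -> tukey_ge B B' ->
  tukey_ge (tadd A B) (tadd A' B').
Proof.
move=> [p [q m]] [p' [q' m']].
exists (fun x => match x with inl a => inl (p a) | inr b => inr (p' b) end),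
  (fun x => match x with inl a => inl (q a) | inr b => inr (q' b) end).
by move=> [a|b] [c|d] //=; [exact: m|exact: m'].
Qed.

Lemma tadd_tsum A B I J (F : I -> trel) (G : J -> trel) :
  tukey_eq A (tsum F) -> tukey_eq B (tsum G) ->
  tukey_eq (tadd A B) (tsum (sum_family F G)).
Proof.
move=> [AF FA] [BG GB].
suff [le ge] : tukey_eq (tadd (tsum F) (tsum G)) (tsum (sum_family F G)).
  by split; [exact: tukey_ge_trans (tadd_ge AF BG) le
            |exact: tukey_ge_trans ge (tadd_ge FA GB)].
pose merge (t : trel -> Type) (x : {i & t (F i)} + {j & t (G j)}) :
    {k & t (sum_family F G k)} :=
  match x with
  | inl (existT i a) => existT (fun k => t (sum_family F G k)) (inl i) a
  | inr (existT j b) => existT (fun k => t (sum_family F G k)) (inr j) b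
  end.
pose split_ (t : trel -> Type) (x : {k & t (sum_family F G k)}) :
    {i & t (F i)} + {j & t (G j)} :=
  match x with
  | existT (inl i) a => inl (existT (fun i => t (F i)) i a)
  | existT (inr j) b => inr (existT (fun j => t (G j)) j b)
  end.
split.
  exists (split_ tneg), (merge tpos) => -[[i|j] a] [[i' c]|[j' c]] //= r.
    have e := tsum_rel_index r; simpl in e; subst i'.
    by move/tsum_relE : r => r; exists (inl i), a, c.
  have e := tsum_rel_index r; simpl in e; subst j'.
  by move/tsum_relE : r => r; exists (inr j), a, c.
exists (merge tneg), (split_ tpos) => x [k c] r.
case: x r => [[i a]|[j b]] r; have /= e := tsum_rel_index r; subst k.
  by move/(@tsum_relE _ (sum_family F G) (inl i)) : r => r; exists i, a, c.
by move/(@tsum_relE _ (sum_family F G) (inr j)) : r => r; exists j, b, c.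
Qed.

Lemma tsum_tprod_teq_tsum I (A : I -> trel) (L : I -> Type) :
  tukey_eq (tsum (fun i => tprod (A i) (teq (L i))))
    (tsum (fun x : {i : I & L i} => A (projT1 x))).
Proof.
split.
  exists (fun x : tneg (tsum (fun x : {i : I & L i} => A (projT1 x))) =>
    existT (fun i => tneg (tprod (A i) (teq (L i))))
      (projT1 (projT1 x)) (projT2 x, projT2 (projT1 x))).
  exists (fun y : tpos (tsum (fun i => tprod (A i) (teq (L i)))) =>
    existT (fun x : {i : I & L i} => tpos (A (projT1 x)))
      (existT _ (projT1 y) (projT2 y).2) (projT2 y).1).
  move=> [[i l] a] [i' [b l']] r.
  have /= e := tsum_rel_index r; subst i'.
  move/tsum_relE : r => [/= ab e]; subst l'.
  by exists (existT _ i l), a, b.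
exists (fun y : tneg (tsum (fun i => tprod (A i) (teq (L i)))) =>
    existT (fun x : {i : I & L i} => tneg (A (projT1 x)))
      (existT _ (projT1 y) (projT2 y).2) (projT2 y).1).
exists (fun x : tpos (tsum (fun x : {i : I & L i} => A (projT1 x))) =>
    existT (fun i => tpos (tprod (A i) (teq (L i))))
      (projT1 (projT1 x)) (projT2 x, projT2 (projT1 x))).
move=> [i [a l]] [[i' l'] b] r.
have /= e := tsum_rel_index r; have iE := existT_inj1 e; subst i'.
have lE := existT_injr e; subst l'; clear e.
move/(@tsum_relE _ (fun x : {i : I & L i} => A (projT1 x)) (existT _ i l)) : r => r.
by exists i, (a, l), (b, l).
Qed.

(** * Convergent sequences in metric spaces *)

Local Open Scope ring_scope.

(** The convergent sequences with their limit, as sets: [embedding_conv] and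
    [conv_embedding] identify them with the images of [omega + 1]. *)
Definition conv_to (X : topologicalType) (T : set X) (x : X) : Prop :=
  [/\ T x, infinite_set T & forall V, nbhs x V -> finite_set (T `\` V)].

Definition accumulation (X : topologicalType) (x : X) : Prop := ~ nbhs x [set x].

(** The part of [seq_rel X] that concerns gaps of [S] at [x] and sequences that
    detect them. *)
Definition seq_at (X : topologicalType) (x : X) : trel :=
  @TRel {S : set X | ~ S x /\ closure S x} {T : set X | conv_to T x}
    (fun S T => infinite_set (sval S `&` sval T)).

Section Metric.
Variables (R : realType) (X : topologicalType) (d : X -> X -> R).
Hypotheses (d_ge0 : forall x y, 0 <= d x y)
  (d_eq0 : forall x y, d x y = 0 <-> x = y)
  (d_sym : forall x y, d x y = d y x)
  (d_tri : forall x y z, d x z <= d x y + d y z)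
  (d_nbhs : forall x (V : set X),
    nbhs x V <-> exists2 e : R, 0 < e & [set y | d x y < e] `<=` V).

Definition dball (x : X) (e : R) : set X := [set y | d x y < e].

Lemma dxx x : d x x = 0. Proof. exact/d_eq0. Qed.

Lemma d_gt0 x y : x <> y -> 0 < d x y.
Proof.
by move=> xy; rewrite lt_neqAle d_ge0 andbT; apply/eqP => /esym/d_eq0.
Qed.

Lemma nbhs_dball x e : 0 < e -> nbhs x (dball x e).
Proof. by move=> e0; apply/d_nbhs; exists e. Qed.

Lemma nbhs_dball_in x y e : d x y < e -> nbhs y (dball x e).
Proof.
move=> xye; apply/d_nbhs; exists (e - d x y); first by rewrite subr_gt0.
by move=> z /=; rewrite /dball /= ltrBrDl; exact: le_lt_trans.
Qed.

Lemma open_dball x e : open (dball x e).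
Proof. by rewrite openE => y; exact: nbhs_dball_in. Qed.

Lemma inv_nat_lt (e : R) : 0 < e -> exists n, (n.+1%:R^-1 : R) < e.
Proof.
move=> e0; exists (Num.truncn e^-1).
by rewrite invf_plt ?posrE ?ltr0Sn// truncnS_gt.
Qed.

Lemma finite_dist (F : set X) x : finite_set F -> ~ F x ->
  exists2 e, 0 < e & forall z, F z -> e <= d x z.
Proof.
move=> /finite_seqP[s ->]; elim: s => [|a s IH] xs; first by exists 1.
have [|e e0 es] := IH; first by move=> xs'; apply: xs; rewrite /= inE; apply/orP; right.
exists (Num.min e (d x a)).
  rewrite lt_min e0 d_gt0// => xa; apply: xs.
  by rewrite xa /= inE eqxx.
move=> z; rewrite /= inE => /orP[/eqP ->|/es ze].
  by rewrite ge_min lexx orbT.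
by rewrite ge_min ze.
Qed.

Lemma accumulation_infinite (x : X) V : accumulation x -> nbhs x V ->
  infinite_set (V `\` [set x]).
Proof.
move=> xacc Vx fV; apply: xacc.
have nx : ~ (V `\` [set x]) x by move=> [_]; apply.
have [e e0 eV] := finite_dist fV nx.
apply: filterS (filterI Vx (nbhs_dball x e0)) => z [Vz zx].
apply: contrapT => nzx; have : e <= d x z by apply: eV.
by rewrite leNgt (zx : d x z < e).
Qed.

(** A point outside such a set is at positive distance from its limit and from
    the finitely many members that are not close to the limit. *)
Lemma conv_closed (Y : set X) (x : X) : Y x ->
  (forall V, nbhs x V -> finite_set (Y `\` V)) -> closed Y.
Proof.
move=> Yx Yconv y Yy; apply: contrapT => nYy.
have xy : x <> y by move=> xy; apply: nYy; rewrite -xy.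
have e0 : 0 < d x y / 2 by rewrite divr_gt0// d_gt0.
have nYBy : ~ (Y `\` dball x (d x y / 2)) y by move=> [].
have [e' e'0 e'Y] := finite_dist (Yconv _ (nbhs_dball x e0)) nYBy.
have m0 : 0 < Num.min e' (d x y / 2) by rewrite lt_min e'0.
have [z [Yz]] := Yy _ (nbhs_dball y m0).
rewrite /dball /= lt_min => /andP[ze' zxy].
have [zx|zx] := ltP (d x z) (d x y / 2).
  have := d_tri x z y; rewrite (d_sym z y); lra.
have : e' <= d y z.
  by apply: e'Y; split => //; rewrite /dball /=; apply/negP; rewrite -leNgt.
by rewrite leNgt ze'.
Qed.

Lemma finite_closed (Y : set X) : finite_set Y -> closed Y.
Proof.
move=> Yfin; have [->|/set0P[x Yx]] := eqVneq Y set0; first exact: closed0.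
by apply: (conv_closed Yx) => V _; exact: finite_setD.
Qed.

Lemma conv_unique (S T : set X) (x y : X) : infinite_set (S `&` T) ->
  (forall V, nbhs x V -> finite_set (S `\` V)) ->
  (forall V, nbhs y V -> finite_set (T `\` V)) -> x = y.
Proof.
move=> STinf Sx Ty; apply: contrapT => xy; apply: STinf.
have e0 : 0 < d x y / 2 by rewrite divr_gt0// d_gt0.
have : finite_set ((S `\` dball x (d x y / 2)) `|` (T `\` dball y (d x y / 2))).
  by rewrite finite_setU; split; [exact: Sx (nbhs_dball _ _)|exact: Ty (nbhs_dball _ _)].
apply: sub_finite_set => z [Sz Tz].
have [xz|xz] := pselect (dball x (d x y / 2) z); last by left.
right; split => //; move: xz; rewrite /dball /= => xz yz.
by have := d_tri x z y; rewrite (d_sym z y); lra.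
Qed.

(** A subset of [T] is closed as soon as it contains the limit or is finite. *)
Lemma conv_not_closed (S T : set X) (x : X) : conv_to T x ->
  not_closed_in S T <-> ~ S x /\ infinite_set (S `&` T).
Proof.
move=> [Tx Tinf Tconv]; split=> [ncl|[nSx STinf]].
  suff : ~ (S x \/ finite_set (S `&` T)) by move=> /not_orP.
  move=> H; apply: ncl; apply: closed_subspaceW; case: H => [Sx|].
    apply: (@conv_closed _ x) => // V /Tconv; apply: sub_finite_set.
    by move=> z [[]].
  exact: finite_closed.
move=> /closed_subspaceP[B Bcl BT].
suff : (B `&` T) x by rewrite BT => -[[]].
split=> //; apply: Bcl => V Vx; apply: contrapT => BV; apply: STinf.
apply: sub_finite_set (Tconv V Vx) => z [Sz Tz]; split => // Vz.
by apply: BV; exists z; split => //; have [] : (B `&` T) z by rewrite BT.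
Qed.

Lemma compact_nat_finite (C : set nat) : compact C -> finite_set C.
Proof.
rewrite compact_cover => /(_ nat C (fun n => [set n])) [].
- by move=> n _; exact: discrete_open.
- by move=> n Cn; exists n.
move=> D _ CD; apply: sub_finite_set (finite_fset D) => n /CD[m mD ->].
exact: mD.
Qed.

(** Neighbourhoods of infinity in [omega + 1] are cofinite, compact sets of
    natural numbers being finite. *)
Lemma embedding_conv (e : omega_succ -> X) :
  embedding e -> conv_to (range e) (e None).
Proof.
move=> [eI eO]; split.
- by exists None.
- move=> /(card_le_finite (A := [set: nat])) H; apply: infinite_nat; apply: H.
  apply: (@card_le_fun _ _ _ _ (fun n => e (Some n))) => [n _|m n _ _ /eI[]//].
  by exists (Some n).
move=> V; rewrite nbhsE => -[W [Wo We] WV].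
have : open (e @^-1` W) by apply/eO; exists W.
rewrite openE => /(_ None We) [C [/compact_nat_finite Cfin _] CW].
apply: sub_finite_set (finite_image (e \o Some) Cfin) => y [[[n|] _ <-] nV].
  exists n => //; apply: contrapT => nC; apply: nV; apply: WV.
  by apply: CW; left; exists n.
by case: nV; exact: WV.
Qed.

(** Outside each ball around the limit [T] has finitely many points, so [T] is
    countable; enumerating it and sending the point at infinity to the limit is
    an embedding because subsets of [T] that contain the limit, or are finite,
    are closed. *)
Lemma conv_embedding (T : set X) (x : X) : conv_to T x ->
  exists2 e : omega_succ -> X, embedding e & T = range e.
Proof.
move=> [Tx Tinf Tconv].
have Tcount : T `\` [set x] #= [set: nat].
  apply/card_eqPle; split; last first.
    by apply/infiniteP; apply: infinite_setD => //; exact: finite_set1.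
  have -> : T `\` [set x] = \bigcup_n (T `\` dball x n.+1%:R^-1).
    apply/seteqP; split=> [y [Ty yx]|y [n _ [Ty yn]]]; last first.
      split => // yx; apply: yn; rewrite yx /dball /= dxx.
      by rewrite invr_gt0 ltr0Sn.
    have [n nd] := inv_nat_lt (d_gt0 (nesym yx)).
    exists n => //; split => //; apply/negP; rewrite -leNgt; exact: ltW.
  apply: bigcup_countable => // n _; apply: finite_set_countable.
  by apply/Tconv/nbhs_dball; rewrite invr_gt0 ltr0Sn.
have /card_set_bijP[i [_ iI iS]] := Tcount.
have /choice[f fP] n : exists y, (T y /\ y <> x) /\ i y = n.
  by have [y Ty <-] := iS n I; exists y.
pose e (p : omega_succ) : X := if p is Some n then f n else x.
have eI : injective e.
  move=> [m|] [n|] //= emn; last 2 first.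
  - by have [[_ fx] _] := fP m; case: fx.
  - by have [[_ fx] _] := fP n; case: fx.
  by have [_ <-] := fP m; rewrite emn; have [_ ->] := fP n.
have eT : T = range e.
  apply/seteqP; split=> [y Ty|_ [[n|] _ <-]//]; last by have [[]] := fP n.
  have [->|yx] := pselect (y = x); first by exists None.
  exists (Some (i y)) => //=; have [[Tf fx] fi] := fP (i y).
  by apply: iI; rewrite ?inE.
exists e => //; split=> // A; split=> [|[B oB ->]].
  rewrite openE => oA; exists (~` (T `\` e @` A)).
    rewrite openC; have [AN|nAN] := pselect (A None).
      have [C [/compact_nat_finite Cfin _] CA] := oA _ AN.
      apply: finite_closed; apply: sub_finite_set (finite_image f Cfin).
      rewrite eT => _ [[[n|] _ <-] nA]; last by case: nA; exists None.
      exists n => //; apply: contrapT => nC; apply: nA; exists (Some n) => //.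
      by apply: CA; left; exists n.
    apply: (@conv_closed _ x).
      by split=> //; case=> p Ap /(eI p None) pN; apply: nAN; rewrite -pN.
    by move=> V /Tconv; apply: sub_finite_set => y [[]].
  apply/seteqP; split=> [p Ap [_]|p /= H]; first by apply; exists p.
  apply: contrapT => nAp; apply: H; split; first by rewrite eT; exists p.
  by move=> [p' Ap' /eI pp']; apply: nAp; rewrite -pp'.
rewrite openE => -[n|] /= Be.
  by apply: (@filterS _ (nbhs n)) (discrete_set1 n) => _ ->.
have Cfin : finite_set [set n | ~ B (f n)].
  apply: card_le_finite (Tconv B _); last by rewrite openE in oB; exact: oB.
  apply: (@card_le_fun _ _ _ _ f) => [n nB|m n _ _ fmn].
    by split => //; have [[]] := fP n.
  by have [_ <-] := fP m; rewrite fmn; have [_ ->] := fP n.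
exists [set n | ~ B (f n)].
  by split; [exact: finite_compact|exact: discrete_closed].
by move=> _ [[n /= nB <-]|-> //]; exact: contrapT.
Qed.

(** The points of [S] are taken from balls of radii tending to zero; infinitely
    many arise because a finite set has positive distance from [x]. *)
Lemma closure_sequence (S V : set X) (x : X) : ~ S x -> closure S x -> nbhs x V ->
  exists Q : set X, [/\ Q `<=` S `&` V, infinite_set Q &
    forall W, nbhs x W -> finite_set (Q `\` W)].
Proof.
move=> nSx Sx Vx.
have /choice[s sP] (n : nat) : exists y, (S y /\ V y) /\ d x y < n.+1%:R^-1.
  have n0 : (0 : R) < n.+1%:R^-1 by rewrite invr_gt0 ltr0Sn.
  by have [y [Sy [Vy xy]]] := Sx _ (filterI Vx (nbhs_dball x n0)); exists y.
exists (range s); split.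
- by move=> _ [n _ <-]; exact: (sP n).1.
- move=> sfin.
  have nsx : ~ range s x by move=> [n _ snx]; apply: nSx; rewrite -snx; exact: (sP n).1.1.
  have [e e0 es] := finite_dist sfin nsx.
  have [n ne] := inv_nat_lt e0.
  have : e <= d x (s n) by apply: es; exists n.
  by rewrite leNgt (lt_trans (sP n).2 ne).
move=> W /d_nbhs[e e0 eW]; have [N Ne] := inv_nat_lt e0.
apply: sub_finite_set (finite_image s (finite_II N)) => _ [[n _ <-] nW].
exists n => //=; rewrite ltnNge; apply/negP => Nn; apply: nW; apply: eW => /=.
apply: lt_le_trans (sP n).2 _; apply: le_trans (ltW Ne).
by rewrite lef_pV2 ?posrE ?ltr0Sn// ler_nat.
Qed.

Lemma closure_accumulation (S : set X) (x : X) : ~ S x -> closure S x -> accumulation x.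
Proof. by move=> nSx Sx /Sx[y [Sy yx]]; apply: nSx; rewrite -yx. Qed.

Lemma conv_to_accumulation (T : set X) (x : X) : conv_to T x -> accumulation x.
Proof.
move=> [_ Tinf Tconv] /Tconv Tfin; apply: Tinf.
have : finite_set (T `\` [set x] `|` [set x]) by rewrite finite_setU.
by apply: sub_finite_set => y Ty; have [->|] := pselect (y = x); [right|left].
Qed.

Lemma accumulation_inhabited (x : X) : accumulation x -> inhabited (tpos (seq_at x)).
Proof.
move=> xacc.
have xcl : closure (~` [set x]) x.
  move=> V Vx; have [y [Vy yx]] := infinite_setN0 (accumulation_infinite xacc Vx).
  by exists y.
have nx : ~ (~` [set x]) x by apply.
have [Q [Qx Qinf Qconv]] := closure_sequence nx xcl filterT.
constructor; exists (Q `|` [set x]); split; first by right.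
  by apply: sub_infinite_set Qinf; exact: subsetUl.
move=> V Vx; apply: sub_finite_set (Qconv V Vx) => y [[//|->] nV].
by case: nV; exact: nbhs_singleton.
Qed.

(** A non-closed set is sent to a point of its closure that it misses; in the
    other direction a set is first thinned to a sequence, which has no other
    such point. *)
Lemma seq_rel_tsum :
  tukey_eq (seq_rel X) (tsum (fun x : {x : X | accumulation x} => seq_at (sval x))).
Proof.
have limP (T : CSplus X) : exists x, conv_to (sval T) x.
  by case: T => T /= [e /embedding_conv econv ->]; exists (e None).
have /choice[lim limE] := limP.
have /choice[thin thinP] (b : {x : {x : X | accumulation x} & tneg (seq_at (sval x))}) :
    exists S : NC X, let: existT x B := b in [/\ sval S `<=` sval B,
      ~ sval S (sval x) & forall V, nbhs (sval x) V -> finite_set (sval S `\` V)].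
  case: b => x [B [nBx Bx]] /=.
  have [Q [QB Qinf Qconv]] := closure_sequence nBx Bx filterT.
  have nQx : ~ Q (sval x) by move=> /QB[].
  have nQ : ~ closed Q.
    move=> Qcl; apply: nQx; apply: Qcl => V Vx; apply: contrapT => QV.
    apply: Qinf; apply: sub_finite_set (Qconv V Vx) => y Qy; split => // Vy.
    by apply: QV; exists y.
  by exists (exist _ Q nQ); split => // y /QB[].
split.
  exists thin, (fun T => existT (fun x : {x : X | accumulation x} => tpos (seq_at (sval x)))
     (exist _ (lim T) (conv_to_accumulation (limE T))) (exist _ (sval T) (limE T))).
  move=> b T /=; rewrite (conv_not_closed _ (limE T)).
  move: (thin b) (thinP b) => S; case: b => x B /= [SB nSx Sconv] [nSlim STinf].
  have xE : x = exist _ (lim T) (conv_to_accumulation (limE T)).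
    case: x {B SB nSx} Sconv => x xacc /= Sconv; apply: eq_exist.
    by apply: (conv_unique STinf Sconv); have [] := limE T.
  subst x; exists (exist _ (lim T) (conv_to_accumulation (limE T))), B.
  exists (exist _ (sval T) (limE T)); split=> //=.
  by apply: sub_infinite_set STinf => y [/SB].
have /choice[gap gapP] (S : NC X) : exists x, ~ sval S x /\ closure (sval S) x.
  case: S => S nS /=; apply: contrapT => H; apply: nS => x Sx.
  by apply: contrapT => nSx; apply: H; exists x.
exists (fun S => existT (fun x : {x : X | accumulation x} => tneg (seq_at (sval x)))
  (exist _ (gap S) (closure_accumulation (gapP S).1 (gapP S).2))
  (exist _ (sval S) (gapP S))).
pose cs x (T : {T : set X | conv_to T x}) : CSplus X :=
  exist _ (sval T) (conv_embedding (svalP T)).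
exists (fun a => cs (sval (projT1 a)) (projT2 a)).
move=> S [x T] r /=; have /= e := tsum_rel_index r; subst x.
move/tsum_relE : r => /= STinf; apply/(conv_not_closed _ (svalP T)).
by split => //; have [] := gapP S.
Qed.

(** A coding of the points near [x] by pairs [(m, z)] with [z : Kn m] turns
    sequences converging to [x] into sequences of finite sets and back, provided
    that a tag [m] is not used arbitrarily close to [x] and that only finitely
    many tags are used away from [x]. *)
Lemma prod_infty_ge_seq_at (Kn : nat -> Type) (x : X) (D : set X)
    (j : X -> {m & Kn m}) : accumulation x -> nbhs x D ->
  (forall y z, D y -> D z -> y <> x -> z <> x -> j y = j z -> y = z) ->
  (forall m, exists2 V, nbhs x V & forall y, D y -> V y -> y <> x -> projT1 (j y) <> m) ->
  (forall V, nbhs x V -> exists N, forall y, D y -> ~ V y -> (projT1 (j y) <= N)%N) ->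
  tukey_ge (prod_infty Kn) (seq_at x).
Proof.
move=> xacc Dx jI jnear jfar.
have /choice[psi psiP] (S : tneg (seq_at x)) : exists F : fin_seq_infty Kn,
    exists2 Q : set X, Q `<=` sval S `&` D &
      forall m z, sval F m z <-> exists2 y, Q y & j y = existT Kn m z.
  case: S => S [nSx Sx] /=.
  have [Q [QSD Qinf Qconv]] := closure_sequence nSx Sx Dx.
  have Qx y : Q y -> y <> x by move=> /QSD[Sy _] yx; apply: nSx; rewrite -yx.
  have QI y z : Q y -> Q z -> j y = j z -> y = z.
    by move=> Qy Qz; apply: jI; [exact: (QSD _ Qy).2|exact: (QSD _ Qz).2|exact: Qx|exact: Qx].
  pose F m : set (Kn m) := [set z | exists2 y, Q y & j y = existT Kn m z].
  have Ffin m : finite_set (F m).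
    have [V Vx Vm] := jnear m; apply: card_le_finite (Qconv V Vx).
    apply/card_le_relP; exists (fun z y => j y = existT Kn m z); split.
      move=> z [y Qy jy]; exists y => //; split => // Vy.
      by apply: (Vm y) => //; [exact: (QSD _ Qy).2|exact: Qx|rewrite jy].
    move=> z z' y _ _ -> e; exact: existT_injr e.
  have Finf : infinite_set [set m | F m !=set0].
    move=> Fm; apply: Qinf.
    have : finite_set (\bigcup_(m in [set m | F m !=set0]) (existT Kn m @` F m)).
      by apply: bigcup_finite => // m _; exact: finite_image.
    apply: card_le_finite; apply: (@card_le_fun _ _ _ _ j) => // y Qy.
    have Fy : F (projT1 (j y)) (projT2 (j y)) by exists y => //; case: (j y).
    exists (projT1 (j y)); first by exists (projT2 (j y)).
    by exists (projT2 (j y)) => //; case: (j y).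
  by exists (exist _ F (conj Ffin Finf)), Q.
apply: (@tukey_ge_default (prod_infty Kn) (seq_at x) psi); first exact: accumulation_inhabited.
move=> [G [Gfin Ginf]] b0 r0.
pose T := [set x] `|` [set y | [/\ D y, y <> x & G (projT1 (j y)) (projT2 (j y))]].
have meet b : i_infty (psi b) (exist _ G (conj Gfin Ginf)) -> infinite_set (sval b `&` T).
  have [Q QSD QE] := psiP b.
  rewrite /i_infty /= => Minf Sfin; apply: Minf; apply: card_le_finite Sfin.
  apply/card_le_relP; exists (fun m y => projT1 (j y) = m); split; last first.
    by move=> m m' y _ _ <-.
  move=> m [z [/QE[y Qy jy] Gz]]; exists y; last by rewrite jy.
  have [Sy Dy] := QSD _ Qy; split => //; right; split => //; last by rewrite jy.
  by move=> yx; case: b {QE} Sy {QSD} => S [/= nSx _]; rewrite yx.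
have Tconv : conv_to T x.
  split; first by left.
    by apply: sub_infinite_set (meet _ r0); exact: subIsetr.
  move=> V Vx; have [N VN] := jfar V Vx.
  have : finite_set (\bigcup_(m in [set m | (m <= N)%N]) (existT Kn m @` G m)).
    apply: bigcup_finite; first exact: (finite_II N.+1).
    by move=> m _; exact: finite_image.
  apply: card_le_finite; apply: (@card_le_fun _ _ _ _ j).
    move=> y [[->|[Dy yx Gy]] nVy]; first by case: nVy; exact: nbhs_singleton.
    exists (projT1 (j y)); first exact: VN.
    by exists (projT2 (j y)) => //; case: (j y).
  move=> y z [[->|[Dy yx Gy]] nVy]; first by case: nVy; exact: nbhs_singleton.
  move=> [[->|[Dz zx Gz]] nVz]; first by case: nVz; exact: nbhs_singleton.
  exact: jI.
by exists (exist _ T Tconv).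
Qed.

(** The same coding, read in the other direction: here it has to be defined on
    all pairs, but need not reach all points near [x]. *)
Lemma seq_at_ge_prod_infty (Kn : nat -> Type) (x : X) (j : {m & Kn m} -> X) :
  inhabited (fin_seq_infty Kn) -> injective j ->
  (forall m, exists2 V, nbhs x V & forall z, ~ V (j (existT Kn m z))) ->
  (forall V, nbhs x V -> exists N, forall m z, (N <= m)%N -> V (j (existT Kn m z))) ->
  tukey_ge (seq_at x) (prod_infty Kn).
Proof.
move=> inh jI jaway jclose.
pose S (F : fin_seq_infty Kn) : set X :=
  [set y | exists m z, sval F m z /\ y = j (existT Kn m z)].
have SP (F : fin_seq_infty Kn) : ~ S F x /\ closure (S F) x.
  split=> [[m [z [_ xE]]]|V /jclose[N NV]].
    by have [V Vx /(_ z)] := jaway m; rewrite -xE; apply; exact: nbhs_singleton.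
  have [m Nm [z Fz]] : exists2 m, (N <= m)%N & sval F m !=set0.
    apply: contrapT => H; have [_] := svalP F; apply.
    apply: sub_finite_set (finite_II N) => m Fm /=.
    by rewrite ltnNge; apply/negP => Nm; apply: H; exists m.
  by exists (j (existT Kn m z)); split; [exists m, z|exact: NV].
apply: (@tukey_ge_default (seq_at x) (prod_infty Kn) (fun F => exist _ (S F) (SP F))) => //.
move=> [T [Tx Tinf Tconv]] F0 /= r0.
pose G m : set (Kn m) := [set z | T (j (existT Kn m z))].
have Gfin m : finite_set (G m).
  have [V Vx nV] := jaway m; apply: card_le_finite (Tconv V Vx).
  apply: (@card_le_fun _ _ _ _ (fun z => j (existT Kn m z))) => //.
  by move=> z z' _ _ /jI; exact: existT_injr.
have meet (F : fin_seq_infty Kn) : infinite_set (S F `&` T) ->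
    infinite_set [set m | sval F m `&` G m !=set0].
  move=> STinf Mfin; apply: STinf.
  have : finite_set (\bigcup_(m in [set m | sval F m `&` G m !=set0])
      ((fun z => j (existT Kn m z)) @` G m)).
    by apply: bigcup_finite => // m _; exact: finite_image.
  apply: sub_finite_set => _ [[m [z [Fz ->]]] Tz].
  by exists m; [exists z|exists z].
have Ginf : infinite_set [set m | G m !=set0].
  by apply: sub_infinite_set (meet _ r0) => m [z [_ Gz]]; exists z.
by exists (exist _ G (conj Gfin Ginf)) => F; exact: meet.
Qed.

(** The annuli around [x] with radii [1 / n] are indexed by the integral part of
    the inverse distance. *)
Definition level (x y : X) : nat := Num.truncn (d x y)^-1.

Lemma level_near (x y : X) n : y <> x -> d x y < n.+1%:R^-1 -> (n < level x y)%N.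
Proof.
move=> yx yn; rewrite /level truncn_gt_nat ltW//.
by rewrite -ltf_pV2 ?posrE ?invr_gt0 ?d_gt0//; [rewrite invrK|exact: nesym].
Qed.

Lemma level_far (x y : X) e : 0 < e -> e <= d x y -> (level x y <= Num.truncn e^-1)%N.
Proof. by move=> e0 ey; apply: le_truncn; rewrite lef_pV2 ?posrE// (lt_le_trans e0). Qed.

(** Mapping each level set into a factor of its own gives a coding as required
    by [prod_infty_ge_seq_at]; [k] chooses the factors. *)
Lemma prod_infty_ge_seq_at_level (Kn : nat -> Type) (x : X) (D : set X)
    (k : nat -> nat) : accumulation x -> nbhs x D -> injective k ->
  (forall n, [set y | [/\ D y, y <> x & level x y = n]] #<= [set: Kn (k n)]) ->
  tukey_ge (prod_infty Kn) (seq_at x).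
Proof.
move=> xacc Dx kI DK.
pose L n := [set y | [/\ D y, y <> x & level x y = n]].
have LK n := (card_le_relP (L n) [set: Kn (k n)]).1 (DK n).
pose J n := sval (cid (LK n)); have JP n := svalP (cid (LK n)).
rewrite -/(J _) in JP.
have [y0 [Dy0 y0x]] := infinite_setN0 (accumulation_infinite xacc Dx).
have [z0 _ _] := (JP (level x y0)).1 y0 (And3 Dy0 y0x erefl).
have /choice[j jP] y : exists s : {m & Kn m}, D y -> y <> x ->
    exists2 z, J (level x y) y z & s = existT Kn (k (level x y)) z.
  have [[Dy yx]|nDy] := pselect (D y /\ y <> x); last first.
    by exists (existT Kn _ z0) => Dy yx; case: nDy.
  have [z _ Jyz] := (JP (level x y)).1 y (And3 Dy yx erefl).
  by exists (existT Kn _ z) => _ _; exists z.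
apply: (@prod_infty_ge_seq_at Kn x D j) => //.
- move=> y y' Dy Dy' yx y'x jyy'.
  have [z Jz jy] := jP y Dy yx; have [z' Jz' jy'] := jP y' Dy' y'x.
  have e : existT Kn (k (level x y)) z = existT Kn (k (level x y')) z' by rewrite -jy -jy'.
  have /kI lE := existT_inj1 e; have Ly' : L (level x y') y' by [].
  move: Ly' z' Jz' jy' e; rewrite -lE => Ly' z' Jz' jy' e.
  have zE := existT_injr e; rewrite -zE in Jz'.
  by apply: ((JP (level x y)).2 y y' z).
- move=> m; have [[n kn]|nk] := pselect (exists n, k n = m).
    exists (dball x n.+1%:R^-1); first by apply: nbhs_dball; rewrite invr_gt0 ltr0Sn.
    move=> y Dy yn yx; have [z _ ->] := jP y Dy yx; rewrite /= -kn => /kI le.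
    by have := level_near yx yn; rewrite le ltnn.
  exists setT; first exact: filterT.
  by move=> y Dy _ yx; have [z _ ->] := jP y Dy yx => /= km; apply: nk; exists (level x y).
- move=> V Vx; have /d_nbhs[e e0 eV] := Vx.
  have [N kN] := finite_nat_bound (finite_image k (finite_II (Num.truncn e^-1).+1)).
  exists N => y Dy nVy; have yx : y <> x.
    by move=> yx; apply: nVy; rewrite yx; exact: nbhs_singleton.
  have [z _ ->] := jP y Dy yx; apply: kN; exists (level x y) => //=.
  rewrite ltnS; apply: level_far => //; rewrite leNgt; apply/negP => ye.
  by apply: nVy; exact: eV.
Qed.

Lemma relP_ge_seq_at (K : Type) (x : X) (D : set X) : accumulation x -> nbhs x D ->
  D #<= [set: K] -> tukey_ge (relP K) (seq_at x).
Proof.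
move=> xacc Dx DK.
apply: (@prod_infty_ge_seq_at_level (fun=> K) x D id) => // n.
by apply: card_le_trans DK; apply: subset_card_le => y [].
Qed.

Definition annulus (x : X) (r' r : R) : set X := dball x r `\` dball x r'.

(** The radii are chosen one after another; making a radius smaller only
    enlarges the annulus outside it. *)
Lemma shrinking_radii (Kn : nat -> Type) (x : X) :
  (forall n r, 0 < r -> exists2 r', 0 < r' & [set: Kn n] #<= annulus x r' r) ->
  exists rho : nat -> R, [/\ forall n, 0 < rho n, forall n, rho n.+1 <= rho n,
    forall n, rho n.+1 <= n.+1%:R^-1 &
    forall n, [set: Kn n] #<= annulus x (rho n.+1) (rho n)].
Proof.
move=> H.
have /choice[c cP] (p : nat * R) : exists r', 0 < p.2 ->
    [/\ 0 < r', r' <= p.2, r' <= p.1.+1%:R^-1 & [set: Kn p.1] #<= annulus x r' p.2].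
  case: p => n r /=; have [r0|r0] := ltP 0 r; last by exists 0.
  have [r' r'0 Kr'] := H n r r0.
  exists (Num.min r' (Num.min r n.+1%:R^-1)) => _; split.
  - by rewrite !lt_min r'0 r0 invr_gt0 ltr0Sn.
  - by rewrite !ge_min lexx !orbT.
  - by rewrite !ge_min lexx !orbT.
  - apply: card_le_trans Kr' (subset_card_le _) => y [yr nyr']; split => // ym.
    by apply: nyr'; apply: lt_le_trans ym _; rewrite ge_min lexx.
pose rho := fix rho n : R := if n is m.+1 then c (m, rho m) else 1.
have rho0 n : 0 < rho n.
  by elim: n => [|n IH] //=; have [] := cP (n, rho n) IH.
exists rho; split=> // n; by have [] := cP (n, rho n) (rho0 n).
Qed.

Lemma seq_at_ge_prod_infty_annulus (Kn : nat -> Type) (x : X) :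
  inhabited (fin_seq_infty Kn) ->
  (forall n r, 0 < r -> exists2 r', 0 < r' & [set: Kn n] #<= annulus x r' r) ->
  tukey_ge (seq_at x) (prod_infty Kn).
Proof.
move=> inh /shrinking_radii[rho [rho0 rhoS rhoV KA]].
have rho_le m n : (m <= n)%N -> rho n <= rho m.
  move=> /subnK <-; elim: (n - m)%N => [//|i IH]; exact: le_trans (rhoS _) IH.
pose A n := annulus x (rho n.+1) (rho n).
have KR n := (card_le_relP [set: Kn n] (A n)).1 (KA n).
pose J n := sval (cid (KR n)); have JP n := svalP (cid (KR n)).
rewrite -/(J _) in JP.
have /choice[j jP] (s : {m & Kn m}) : exists y,
    A (projT1 s) y /\ J (projT1 s) (projT2 s) y.
  by have [y Ay Jy] := (JP (projT1 s)).1 (projT2 s) I; exists y.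
apply: (@seq_at_ge_prod_infty Kn x j) => //.
- move=> [m z] [m' z'] jE.
  have [[/= m1 m2] Jm] := jP (existT Kn m z); have [[/= m1' m2'] Jm'] := jP (existT Kn m' z').
  move: m1 m2 Jm; rewrite jE => m1 m2 Jm.
  have mm' : m = m'.
    have [mm'|mm'|//] := ltngtP m m'.
      by case: m2; apply: lt_le_trans (rho_le _ _ mm'); exact: m1'.
    by case: m2'; apply: lt_le_trans (rho_le _ _ mm'); exact: m1.
  subst m'; congr existT; exact: ((JP m).2 _ _ _ I I Jm Jm').
- move=> m; exists (dball x (rho m.+1)); first exact: nbhs_dball.
  by move=> z; have [[]] := jP (existT Kn m z).
move=> V /d_nbhs[e e0 eV]; have [N Ne] := inv_nat_lt e0.
exists N.+1 => m z Nm; apply: eV => /=; have [[/= + _ _]] := jP (existT Kn m z).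
move=> mz; apply: lt_trans Ne; apply: lt_le_trans mz _.
exact: le_trans (rho_le _ _ Nm) (rhoV _).
Qed.

(** A ball is covered by its centre and countably many annuli, so for infinite
    [K] they cannot all be smaller than [K]; a finite [K] embeds into the ball,
    and its image keeps a positive distance from [x]. *)
Lemma annulus_large (K : Type) (x : X) r : accumulation x -> 0 < r ->
  ~ (dball x r #<= [set: K]) -> exists2 r', 0 < r' & [set: K] #<= annulus x r' r.
Proof.
move=> xacc r0 rK.
have binf := accumulation_infinite xacc (nbhs_dball x r0).
have [Kfin|Kinf] := pselect (finite_set [set: K]).
  have /(card_le_funP (infinite_setN0 binf))[f [fb fI]] :
      [set: K] #<= dball x r `\` [set x].
    apply: card_le_trans (finite_set_countable Kfin) _; exact/infiniteP.
  have nfx : ~ range f x by move=> [z _ fz]; have [_ nz] := fb z I; apply: nz.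
  have [e e0 ef] := finite_dist (finite_image f Kfin) nfx.
  exists e => //; apply: (@card_le_fun _ _ _ _ f) => // z _; split; first by have [] := fb z I.
  by apply/negP; rewrite -leNgt; apply: ef; exists z.
apply: contrapT => H; apply: rK.
have small n : annulus x n.+1%:R^-1 r #<= [set: K].
  by apply: card_nle => Kn; apply: H; exists (n.+1%:R^-1); rewrite ?invr_gt0 ?ltr0Sn.
apply: card_le_trans (infinite_setU_le Kinf _ (infinite_bigcup_nat_le Kinf small)).
  apply: (subset_card_le (_ : _ `<=` [set x] `|` _)) => y yr.
  have [->|yx] := pselect (y = x); first by left.
  right; have [n ny] := inv_nat_lt (d_gt0 (nesym yx)); exists n => //; split => //.
  by apply/negP; rewrite -leNgt ltW.
have [z _] := infinite_setN0 Kinf.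
by apply: (@card_le_fun _ _ _ _ (fun=> z)) => // a b -> ->.
Qed.

Lemma separable_base : separable X -> exists b : nat -> set X,
  forall (x : X) V, nbhs x V -> exists m, nbhs x (b m) /\ b m `<=` V.
Proof.
move=> [D /countable_injP[f fI] Ddense].
exists (fun m => if unpickle m is Some (i, n) then
  [set y | exists q, [/\ D q, f q = i & d q y < (n : nat).+1%:R^-1]] else set0).
move=> x V /d_nbhs[e e0 eV].
have [n ne] : exists n, (n.+1%:R^-1 : R) < e / 2 by apply: inv_nat_lt; rewrite divr_gt0.
have n0 : (0 : R) < n.+1%:R^-1 by rewrite invr_gt0 ltr0Sn.
have [|q [qx Dq]] := Ddense (dball x n.+1%:R^-1) _ (open_dball _ _).
  by exists x; rewrite /dball /= dxx.
exists (pickle (f q, n)); rewrite pickleK; split.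
  apply: filterS (nbhs_dball_in (_ : d q x < n.+1%:R^-1)); last by rewrite d_sym.
  by move=> y qy; exists q.
move=> y [q' [Dq' fq' q'y]]; apply: eV => /=.
have qq' : q' = q by apply: fI; rewrite ?inE.
subst q'; apply: le_lt_trans (d_tri x q y) _; move: qx q'y ne.
by rewrite /dball /=; move: (n.+1%:R^-1) => t; lra.
Qed.

End Metric.

Lemma countable_discrete_subset (X : topologicalType) (b : nat -> set X) (A : set X) :
  (forall (x : X) V, nbhs x V -> exists m, nbhs x (b m) /\ b m `<=` V) ->
  (forall x : X, A x -> exists2 V, nbhs x V & V `&` A `<=` [set x]) -> countable A.
Proof.
move=> bbase Adisc; apply/card_le_relP.
exists (fun x m => b m x /\ b m `&` A `<=` [set x]); split.
  move=> x /Adisc[V /bbase[m [bx bV]] VA]; exists m => //; split.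
    exact: nbhs_singleton.
  by move=> y [/bV Vy Ay]; apply: VA.
by move=> x x' m Ax Ax' [bx bA] [bx' bA']; apply: bA'.
Qed.

(** * Cofinality and increasing sequences of cardinals *)

Lemma cof_omega_infinite (K : Type) : cof_omega K -> infinite_set [set: K].
Proof.
move=> [r _ [[C _ CN] _]] /(card_le_finite (card_leT C)).
by rewrite (eq_finite_set CN); exact: infinite_nat.
Qed.

Lemma cof_omega_cover T (K : Type) (V : nat -> set T) :
  infinite_set [set: K] -> (forall m, ~ ([set: K] #<= V m)) ->
  [set: K] #<= \bigcup_m V m -> cof_omega K.
Proof.
move=> Kinf Vsmall /card_leT_funP[f [fV fI]].
apply: (@cof_omega_bigcup K (fun m => f @^-1` V m)) => // [m KV|x].
  apply: (Vsmall m); apply: card_le_trans KV _.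
  by apply: (@card_le_fun _ _ _ _ f) => // x y _ _ /fI.
by have [m _ Vm] := fV x; exists m.
Qed.

Lemma fin_seq_infty_inhabited (Kn : nat -> Type) N :
  (forall n, (N <= n)%N -> inhabited (Kn n)) -> inhabited (fin_seq_infty Kn).
Proof.
move=> KN.
have E n : exists F : set (Kn n), finite_set F /\ ((N <= n)%N -> F !=set0).
  have [Nn|nN] := boolP (N <= n)%N; last by exists set0.
  by have [z] := KN n Nn; exists [set z]; split => // _; exists z.
constructor; exists (fun n => sval (cid (E n))); split=> [n|].
  by have [] := svalP (cid (E n)).
apply: infinite_nat_unbounded => m; exists (maxn m N); first exact: leq_maxl.
by have [_] := svalP (cid (E (maxn m N))); apply; exact: leq_maxr.
Qed.

(** Conditions that hold from some index on can be met one after another, at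
    indices that increase. *)
Lemma eventually_injective (P : nat -> nat -> Prop) :
  (forall m, exists N, forall n, (N <= n)%N -> P m n) ->
  exists k : nat -> nat, injective k /\ forall m, P m (k m).
Proof.
move=> /choice[N NP]; pose k m := (\sum_(i < m.+1) (N i).+1)%N.
exists k; split=> [m n|m]; last first.
  by apply: NP; rewrite /k big_ord_recr /= ; apply: leq_trans (leq_addl _ _).
have kS i : (k i < k i.+1)%N by rewrite /k (big_ord_recr i.+1) /= addnS ltnS leq_addr.
have klt i j : (i < j)%N -> (k i < k j)%N.
  by elim: j => // j IH; rewrite ltnS leq_eqVlt => /orP[/eqP ->//|/IH/ltn_trans]; exact.
by move=> kmn; case: (ltngtP m n) => // /klt; rewrite kmn ltnn.
Qed.

Section Increasing.
Variables (K : Type) (Kn : nat -> Type) (KnK : increasing_up_to Kn K).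

Lemma increasing_le m n : (m <= n)%N -> [set: Kn m] #<= [set: Kn n].
Proof.
have [KS _ _] := KnK.
move=> /subnK <-; elim: (n - m)%N => [|i IH]; first exact: card_lexx.
by apply: card_le_trans IH _; have [] := KS (i + m)%N.
Qed.

Lemma increasing_lt n : ~ ([set: K] #<= [set: Kn n]).
Proof.
have [KS KK _] := KnK => Kle; have [_] := KS n; apply.
exact: card_le_trans (KK n.+1) Kle.
Qed.

(** By comparability a set not bounded by any [Kn n] is an upper bound of all of
    them; the copy of it inside [K] is needed because suprema are only tested on
    subsets of [K]. *)
Lemma increasing_small_le T (A : set T) : ~ ([set: K] #<= A) ->
  exists N, forall n, (N <= n)%N -> A #<= [set: Kn n].
Proof.
move=> KA; suff [N AN] : exists N, A #<= [set: Kn N].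
  by exists N => n Nn; exact: card_le_trans AN (increasing_le Nn).
apply: contrapT => nA; apply: KA.
have [|AK] := card_le_total [set: K] A; first by [].
have [KS _ Kub] := KnK.
have [K0|/set0P K0] := eqVneq [set: K] set0.
  by rewrite K0; exact: card_ge0.
have [f [_ fI]] := card_le_funP K0 AK.
have fAA : f @` A #= A by apply: inj_card_eq => x y /set_mem Ax /set_mem; exact: fI.
rewrite -(card_le_eqr fAA); apply: Kub => n.
by rewrite (card_le_eqr fAA); apply: card_nle => An; apply: nA; exists n.
Qed.

Lemma increasing_inhabited n : (1 <= n)%N -> inhabited (Kn n).
Proof.
case: n => // n _; apply: contrapT => nK; have [/(_ n)[_ +] _ _] := KnK; apply.
have -> : [set: Kn n.+1] = set0 by rewrite -subset0 => z _; apply: nK.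
exact: card_ge0.
Qed.

End Increasing.

(** * Points classified by the size of their neighbourhoods *)

Section Space.
Variables (R : realType) (X : topologicalType) (d : X -> X -> R).
Hypotheses (d_ge0 : forall x y, 0 <= d x y)
  (d_eq0 : forall x y, d x y = 0 <-> x = y)
  (d_sym : forall x y, d x y = d y x)
  (d_tri : forall x y z, d x z <= d x y + d y z)
  (d_nbhs : forall x (V : set X),
    nbhs x V <-> exists2 e : R, 0 < e & [set y | d x y < e] `<=` V).
Variable b : nat -> set X.
Hypothesis b_base :
  forall (x : X) V, nbhs x V -> exists m, nbhs x (b m) /\ b m `<=` V.
Variables (U : X -> set X) (hU : min_card_open_nbhs U).
Variables (K : Type) (hK : [set: K] #= [set: X]).

Lemma U_le x V : nbhs x V -> U x #<= V.
Proof.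
rewrite nbhsE => -[W Wo WV]; apply: card_le_trans (subset_card_le WV).
by have [_] := hU x; apply.
Qed.

Lemma nbhs_U x : nbhs x (U x).
Proof. by have [/open_nbhs_nbhs] := hU x. Qed.

Lemma K_inhabited (x : X) : inhabited K.
Proof.
have /card_eqPle[_ /card_leT_funP[f _]] := hK.
by constructor; exact: (f x).
Qed.

Lemma sub_K (A : set X) : A #<= [set: K].
Proof. by rewrite (card_le_eqr hK); exact: card_leT. Qed.

Lemma accumulation_K_infinite (x : X) : accumulation x -> infinite_set [set: K].
Proof.
move=> xacc; rewrite (eq_finite_set hK).
apply: sub_infinite_set (accumulation_infinite d_ge0 d_eq0 d_nbhs xacc filterT).
by [].
Qed.

Lemma not_accumulation_U (x : X) : ~ accumulation x -> U x #<= [set x].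
Proof. by move=> /contrapT; exact: U_le. Qed.

Lemma M_card_accumulation (x : X) : infinite_set [set: K] -> M_card U K x ->
  accumulation x.
Proof.
move=> Kinf /card_eqPle[_ KU] nx; apply: Kinf.
apply: card_le_finite KU _; apply: card_le_finite (finite_set1 x).
exact: U_le.
Qed.

Lemma K_le_dball (x : X) r : 0 < r -> M_card U K x -> [set: K] #<= dball d x r.
Proof.
move=> r0 /card_eqPle[_ KU]; apply: card_le_trans KU (U_le _).
exact: nbhs_dball.
Qed.

(** A shrinking sequence of balls with large differences exists as soon as
    every ball contains a smaller one whose complement in it is large; the
    converse holds because balls and neighbourhood bases refine each other. *)
Lemma M_card_plusP (x : X) : M_card U K x ->
  M_card_plus U K x <->
  forall r, 0 < r -> exists2 r', 0 < r' & [set: K] #<= annulus d x r' r.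
Proof.
move=> xK; split.
  move=> [_ [B [Bnbhs Bbase] BK]] r r0.
  have [n Bn] := Bbase _ (nbhs_dball d_nbhs x r0).
  have /d_nbhs[r' r'0 Br'] := Bnbhs n.+1; exists r' => //.
  have /card_eqPle[_ KB] := BK n; apply: card_le_trans KB (subset_card_le _).
  by move=> y [/Bn yr nBy]; split => // /Br'.
move=> KA; have [rho [rho0 _ rhoV rhoK]] := @shrinking_radii _ _ d (fun=> K) x (fun=> KA).
split=> //.
exists (fun n => dball d x (rho n)); last first.
  by move=> n; apply/card_eqPle; split; [exact: sub_K|exact: rhoK].
split=> [n|V /d_nbhs[e e0 eV]]; first exact: nbhs_dball.
have [n ne] := inv_nat_lt e0; exists n.+1; apply: subset_trans eV => y /= yn.
by apply: lt_le_trans yn (le_trans (rhoV n) (ltW ne)).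
Qed.

Lemma M_card_minus_radius (x : X) : M_card_minus U K x ->
  exists2 r, 0 < r & forall r', 0 < r' -> ~ ([set: K] #<= annulus d x r' r).
Proof.
move=> [xK /(M_card_plusP xK)]; apply: contra_notP => H r r0.
apply: contrapT => nr; apply: H; exists r => // r' r'0 Kr'.
by apply: nr; exists r'.
Qed.

Lemma M_card_plus_accumulation (x : X) : M_card_plus U K x -> accumulation x.
Proof.
move=> xp nx; have [xK _] := xp.
have [r r0 rx] := (d_nbhs _ _).1 nx.
have [z] := K_inhabited x.
have [r' r'0 /card_leT_funP[f [fA _]]] := (M_card_plusP xK).1 xp r r0.
have [/rx fx nr'] := fA z; apply: nr'; rewrite fx /dball /= dxx//.
Qed.

(** Close to such a point all other points have neighbourhoods smaller than [K],
    since they lie inside small annuli; so [M_card_minus U K] is discrete. *)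
Lemma M_card_minus_countable : countable (M_card_minus U K).
Proof.
apply: (countable_discrete_subset b_base) => x xm.
have [r r0 rK] := M_card_minus_radius xm.
exists (dball d x r); first exact: nbhs_dball.
move=> y [xyr [yK _]]; apply: contrapT => yx.
have xy0 : 0 < d x y by apply: d_gt0 => // xy; apply: yx.
have xy2 : 0 < d x y / 2 by rewrite divr_gt0.
apply: (rK _ xy2); have /card_eqPle[_ KU] := yK.
apply: card_le_trans KU (U_le _).
apply: filterS (filterI (nbhs_dball_in d_tri d_nbhs xyr) (nbhs_dball d_nbhs y xy2)).
move=> z [zr yz]; split => //; move: yz; rewrite /dball /= => yz xz.
by have := d_tri x z y; rewrite (d_sym z y); lra.
Qed.

(** If [U x] is at most [L], so is a basic neighbourhood of [x] contained in it,
    and there are only countably many of those. *)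
Lemma low_le (L : Type) : ~ countable [set: K] ->
  [set: K] #<= [set x | U x #<= [set: L]] -> [set: K] #<= [set: L].
Proof.
move=> Kunc Klow.
pose V m := if `[< b m #<= [set: L] >] then b m else set0.
apply: (@uncountable_bigcup_nat_le _ V) => // [m|].
  by rewrite /V; case: asboolP => // _; exact: card_ge0.
apply: card_le_trans Klow (subset_card_le _) => x /= UL.
have [m [bx bU]] := b_base (nbhs_U x).
exists m => //; rewrite /V asboolT; first exact: nbhs_singleton.
exact: card_le_trans (subset_card_le bU) UL.
Qed.

Lemma small_base (x : X) : ~ ([set: K] #<= U x) ->
  exists m, nbhs x (b m) /\ ~ ([set: K] #<= b m).
Proof.
have [m [bx bU]] := b_base (nbhs_U x) => nKU; exists m; split => // Kb; apply: nKU.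
exact: card_le_trans Kb (subset_card_le bU).
Qed.

Lemma M_cardP (x : X) : [set: K] #<= U x -> M_card U K x.
Proof. by move=> KU; apply/card_eqPle; split => //; exact: sub_K. Qed.

(** Otherwise countably many small annuli and the centre make up a ball of
    size [K]. *)
Lemma M_card_minus0 (x : X) : infinite_set [set: K] -> ~ cof_omega K ->
  ~ M_card_minus U K x.
Proof.
move=> Kinf ncof xm; have [r r0 rK] := M_card_minus_radius xm.
pose V n := if n is m.+1 then annulus d x m.+1%:R^-1 r else [set x].
apply: ncof; apply: (@cof_omega_cover _ K V) => // [[|m] KV|].
- by apply: Kinf; exact: card_le_finite KV (finite_set1 x).
- by apply: rK KV; rewrite invr_gt0 ltr0Sn.
apply: card_le_trans (K_le_dball r0 xm.1) (subset_card_le _) => y yr.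
have [->|yx] := pselect (y = x); first by exists 0%N.
have [n ny] := inv_nat_lt (d_gt0 d_ge0 d_eq0 (nesym yx)).
by exists n.+1 => //; split => //; apply/negP; rewrite -leNgt ltW.
Qed.

(** The other points are covered by countably many small basic sets. *)
Lemma K_le_M_card_plus : infinite_set [set: K] -> ~ cof_omega K ->
  [set: K] #<= M_card_plus U K.
Proof.
move=> Kinf ncof; apply: contrapT => nK.
pose V n := if n is m.+1 then
  (if `[< [set: K] #<= b m >] then set0 else b m) else M_card_plus U K.
apply: (ncof); apply: (@cof_omega_cover _ K V) => // [[|m]//=|].
  case: asboolP => // _ K0; apply: Kinf; apply: card_le_finite K0 _.
  exact: finite_set0.
rewrite (card_le_eql hK); apply: subset_card_le => x _.
have [xp|nxp] := pselect (M_card_plus U K x); first by exists 0%N.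
have nKU : ~ ([set: K] #<= U x).
  by move=> /M_cardP xK; exact: (M_card_minus0 Kinf ncof (conj xK nxp)).
have [m [bx nKb]] := small_base nKU.
by exists m.+1 => //=; rewrite asboolF//; exact: nbhs_singleton.
Qed.

Lemma seq_at_ge_relP (x : X) : M_card_plus U K x -> tukey_ge (seq_at x) (relP K).
Proof.
move=> xp; apply: (seq_at_ge_prod_infty_annulus d_nbhs).
  by apply: (@fin_seq_infty_inhabited _ 0%N) => n _; exact: K_inhabited x.
by move=> _; exact: ((M_card_plusP xp.1).1 xp).
Qed.

(** Every ball around [x] contains [U x] up to cardinality and is therefore
    larger than [L], so [annulus_large] applies to it. *)
Lemma seq_at_ge_relP_lt (x : X) (L : Type) : accumulation x -> inhabited L ->
  ~ (U x #<= [set: L]) -> tukey_ge (seq_at x) (relP L).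
Proof.
move=> xacc Linh UL; apply: (seq_at_ge_prod_infty_annulus d_nbhs).
  exact: (@fin_seq_infty_inhabited _ 0%N).
move=> _ r r0; apply: (annulus_large d_ge0 d_eq0 d_nbhs xacc r0) => rL; apply: UL.
exact: card_le_trans (U_le (nbhs_dball d_nbhs x r0)) rL.
Qed.

Lemma relP_K_ge_seq_at (x : X) : accumulation x -> tukey_ge (relP K) (seq_at x).
Proof.
move=> xacc; apply: (relP_ge_seq_at d_ge0 d_eq0 d_nbhs xacc (D := setT)).
- exact: filterT.
- exact: sub_K.
Qed.

Section Cofinality.
Variables (Kn : nat -> Type) (KnK : increasing_up_to Kn K).

(** Each level set near [x] is smaller than [K], hence fits into [Kn m] for all
    large [m], and distinct factors can be used for distinct levels. *)
Lemma prod_infty_ge_seq_at_minus (x : X) : accumulation x -> M_card_minus U K x ->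
  tukey_ge (prod_infty Kn) (seq_at x).
Proof.
move=> xacc xm; have [r r0 rK] := M_card_minus_radius xm.
pose L n := [set y | [/\ dball d x r y, y <> x & level d x y = n]].
have [|k [kI Lk]] := @eventually_injective (fun n m => L n #<= [set: Kn m]).
  move=> n; apply: (increasing_small_le KnK) => KL.
  have n0 : (0 : R) < n.+1%:R^-1 by rewrite invr_gt0 ltr0Sn.
  apply: (rK _ n0); apply: card_le_trans KL (subset_card_le _).
  move=> y [yr yx yn]; split => // /(level_near d_ge0 d_eq0 yx).
  by rewrite yn ltnn.
exact: (prod_infty_ge_seq_at_level d_ge0 d_eq0 d_nbhs xacc (nbhs_dball d_nbhs x r0) kI).
Qed.

(** All balls have size [K], which is more than each [Kn n]. *)
Lemma seq_at_ge_prod_infty_minus (x : X) : accumulation x -> M_card U K x ->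
  tukey_ge (seq_at x) (prod_infty Kn).
Proof.
move=> xacc xK; apply: (seq_at_ge_prod_infty_annulus d_nbhs).
  exact: fin_seq_infty_inhabited (increasing_inhabited KnK).
move=> n r r0; apply: (annulus_large d_ge0 d_eq0 d_nbhs xacc r0) => rL.
exact: (increasing_lt KnK (card_le_trans (K_le_dball r0 xK) rL)).
Qed.

End Cofinality.

Variables (lambda : Type) (hlambda : [set: lambda] #= M_card_plus U K).
Variables (mu : Type) (hmu : [set: mu] #= M_card_minus U K).

Local Notation seq_family := (fun x : {x : X | accumulation x} => seq_at (sval x)).

Lemma seq_family_inhabited x : inhabited (tpos (seq_family x)).
Proof. exact: accumulation_inhabited d_ge0 d_eq0 d_nbhs _ (svalP x). Qed.

(** All accumulation points inject into [M_card_plus U K], which has full size,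
    and [relP K] is above each [seq_at x]. *)
Lemma tsum_seq_at_not_cof_omega : ~ cof_omega K ->
  tukey_eq (tsum seq_family) (tsum (fun _ : lambda => relP K)).
Proof.
move=> ncof; have /card_eqPle[lp pl] := hlambda.
have [g [gp gI]] := card_leT_funP lp.
have [|f [_ fI]] := @card_leT_funP {x : X | accumulation x} lambda setT.
  have [[x xacc]|nacc] := pselect (exists x : X, accumulation x); last first.
    apply/card_le_relP; exists (fun _ _ => False).
    by split=> // x _; case: nacc; exists (sval x); exact: svalP.
  have KX : [set: X] #<= [set: K] by rewrite (card_le_eqr hK).
  apply: card_le_trans (card_le_trans (card_le_trans KX
    (K_le_M_card_plus (accumulation_K_infinite xacc) ncof)) pl).
  by apply: (@card_le_fun _ _ _ _ sval) => // y z _ _ /eq_sig_hprop; apply.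
apply: (@tsum_eq _ _ _ _ (fun l => exist _ (g l) (M_card_plus_accumulation (gp l))) f) => //.
- by move=> l l' /(congr1 sval) /gI.
- by move=> l /=; exact: seq_at_ge_relP.
- by move=> [x xacc] /=; exact: relP_K_ge_seq_at.
- exact: seq_family_inhabited.
- move=> l; apply: (@fin_seq_infty_inhabited _ 0%N) => n _.
  exact: K_inhabited (g l).
Qed.

Section CofinalityOmega.
Variables (Kn : nat -> Type) (KnK : increasing_up_to Kn K).
Hypothesis Kinf : infinite_set [set: K].

(** The points of [M_card_plus] and [M_card_minus] match the first two families
    of summands.  The family [G] stands for [relS]: its summands must be realized
    at further points by [gs], and must bound the points with small
    neighbourhoods, each by its own summand according to [J]. *)
Lemma tsum_seq_at_cof_omega (S : Type) (G : S -> trel) (J : X -> S -> Prop)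
    (gl : lambda -> X) (gs : S -> X) :
  (forall l, M_card_plus U K (gl l)) -> injective gl ->
  injective gs -> (forall l s, gl l <> gs s) ->
  (forall s, [/\ ~ M_card_minus U K (gs s), accumulation (gs s),
    tukey_ge (seq_at (gs s)) (G s) & inhabited (tpos (G s))]) ->
  (forall x, accumulation x -> ~ ([set: K] #<= U x) ->
    exists2 s, J x s & tukey_ge (G s) (seq_at x)) ->
  (forall x x' s, J x s -> J x' s -> x = x') ->
  tukey_eq (tsum seq_family) (tsum (sum_family
    (sum_family (fun _ : lambda => relP K) (fun _ : mu => prod_infty Kn)) G)).
Proof.
move=> glp glI gsI gls gsP Jt JI.
have /card_eqPle[_ /card_le_relP[Rl [Rlt RlI]]] := hlambda.
have /card_eqPle[mum /card_le_relP[Rm [Rmt RmI]]] := hmu.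
have [gm [gmm gmI]] := card_leT_funP mum.
pose g0 (i : lambda + mu + S) := match i with
  | inl (inl l) => gl l | inl (inr m) => gm m | inr s => gs s end.
have g0acc i : accumulation (g0 i).
  case: i => [[l|m]|s] /=; first exact: M_card_plus_accumulation (glp l).
    by apply: M_card_accumulation => //; exact: (gmm m).1.
  by have [] := gsP s.
have g0I : injective g0.
  move=> [[l|m]|s] [[l'|m']|s'] //= e.
  - by rewrite (glI _ _ e).
  - by have [_ []] := gmm m'; rewrite -e.
  - by case: (gls l s').
  - by have [_ []] := gmm m; rewrite e.
  - by rewrite (gmI _ _ e).
  - by have [+ _ _ _] := gsP s'; rewrite -e; case.
  - by case: (gls l' s).
  - by have [+ _ _ _] := gsP s; rewrite e; case.
  - by rewrite (gsI _ _ e).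
pose spec x (i : lambda + mu + S) := match i with
  | inl (inl l) => M_card_plus U K x /\ Rl x l
  | inl (inr m) => M_card_minus U K x /\ Rm x m
  | inr s => J x s /\ tukey_ge (G s) (seq_at x) end.
have /choice[f fP] (x : {x : X | accumulation x}) : exists i, spec (sval x) i.
  case: x => x xacc /=; have [xp|nxp] := pselect (M_card_plus U K x).
    by have [l _ Rxl] := Rlt x xp; exists (inl (inl l)).
  have [/M_cardP xK|nxK] := pselect ([set: K] #<= U x).
    have xm : M_card_minus U K x by [].
    by have [m _ Rxm] := Rmt x xm; exists (inl (inr m)).
  by have [s Jxs Gs] := Jt x xacc nxK; exists (inr s).
apply: (@tsum_eq _ _ _ _ (fun i => exist _ (g0 i) (g0acc i)) f).
- by move=> i i' /(congr1 sval) /g0I.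
- move=> [[l|m]|s] /=; first exact: seq_at_ge_relP.
    apply: (seq_at_ge_prod_infty_minus KnK (g0acc (inl (inr m)))).
    exact: (gmm m).1.
  by have [] := gsP s.
- move=> x x' fx; have := fP x'; rewrite -fx; have := fP x.
  case: x {fx} => x xacc; case: x' => x' xacc' /= xf xf'; apply: eq_exist.
  move: (f _) xf xf' => [[l|m]|s] /= [x1 x2] [x1' x2'].
  + exact: RlI x2 x2'.
  + exact: RmI x2 x2'.
  + exact: JI x1 x1'.
- move=> x; have := fP x; case: (f x) => [[l|m]|s] /= [x1 x2] //.
    exact: relP_K_ge_seq_at (svalP x).
  exact: prod_infty_ge_seq_at_minus (svalP x) x1.
- exact: seq_family_inhabited.
- move=> [[l|m]|s] /=; last by have [] := gsP s.
    by apply: (@fin_seq_infty_inhabited _ 0%N) => n _; exact: K_inhabited (gl l).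
  exact: fin_seq_infty_inhabited (increasing_inhabited KnK).
Qed.

(** For countable [K] every accumulation point has neighbourhoods of full size,
    so that no summand is left for [relS]. *)
Lemma tsum_seq_at_cof_omega_countable (G : void -> trel) : countable [set: K] ->
  tukey_eq (tsum seq_family) (tsum (sum_family
    (sum_family (fun _ : lambda => relP K) (fun _ : mu => prod_infty Kn)) G)).
Proof.
move=> Kcount; have /card_eqPle[lp _] := hlambda.
have [g [gp gI]] := card_leT_funP lp.
apply: (@tsum_seq_at_cof_omega void G (fun _ _ => False) g (of_void X)) => //;
  try by move=> [].
move=> x xacc []; apply: card_le_trans Kcount _; apply/infiniteP.
have := accumulation_infinite d_ge0 d_eq0 d_nbhs xacc (nbhs_U x).
by apply: sub_infinite_set; exact: subDsetl.
Qed.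

(** The points of a set of size [K] can be listed so that each of countably
    many pieces again has size [K].  Whichever of the points of [M_card_plus]
    and the points with small neighbourhoods form such a set, it has room for
    all the summands of [relS]. *)
Lemma relS_points : ~ countable [set: K] ->
  exists (gl : lambda -> X) (gs : {n & Kn n} -> X),
  [/\ forall l, M_card_plus U K (gl l), injective gl, injective gs,
    forall l s, gl l <> gs s &
    forall s, ~ M_card_minus U K (gs s) /\ ~ (U (gs s) #<= [set: Kn (projT1 s)])].
Proof.
move=> Kunc; have /card_eqPle[lp pl] := hlambda.
have Knl n : [set: Kn n] #<= [set: K] by have [_ + _] := KnK; apply.
have /card_leT_funP[pr [_ prI]] := card_le_setX_nat Kinf.
have [] : [set: K] #<= M_card_plus U K \/ [set: K] #<= [set x | ~ ([set: K] #<= U x)].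
  have KX : [set: K] #<= (M_card_plus U K `|` [set x | ~ ([set: K] #<= U x)]) `|`
      M_card_minus U K.
    rewrite (card_le_eql hK); apply: subset_card_le => x _.
    have [/M_cardP xK|nxK] := pselect ([set: K] #<= U x); last by left; right.
    by have [xp|nxp] := pselect (M_card_plus U K x); [left; left|right].
  have [/(infinite_le_setU Kinf)//|Km] := infinite_le_setU Kinf KX.
  by case: Kunc; exact: card_le_trans Km M_card_minus_countable.
(* [h] lists points of [M_card_plus] in pieces indexed by [nat]: piece [0] serves
   [lambda], and piece [n + 1] serves [Kn n]. *)
- move=> Kp; have [h [hp hI]] := card_leT_funP Kp.
  have Kl : [set: lambda] #<= [set: K] by apply: card_le_trans lp (sub_K _).
  have [il [_ ilI]] := card_leT_funP Kl.
  have Kn_fun n : exists i : Kn n -> K, injective i.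
    by have [i [_ iI]] := card_leT_funP (Knl n); exists i.
  pose i n := sval (cid (Kn_fun n)); have iI n : injective (i n) := svalP (cid (Kn_fun n)).
  exists (fun l => h (pr (il l, 0%N))).
  exists (fun s => h (pr (i (projT1 s) (projT2 s), (projT1 s).+1))); split.
  + by move=> l; exact: hp.
  + by move=> l l' /hI /prI [/ilI].
  + move=> [n z] [n' z'] /hI /prI /= [+ nn']; subst n'.
    by move=> /iI ->.
  + by move=> l s /hI /prI.
  + move=> s; have [sK _] := hp (pr (i (projT1 s) (projT2 s), (projT1 s).+1)).
    split=> [[_]|]; first by apply; exact: hp.
    have /card_eqPle[_ KU] := sK => /(card_le_trans KU).
    exact: (increasing_lt KnK).
move=> Ks; have [h [hs hI]] := card_leT_funP Ks.
have [gl [glp glI]] := card_leT_funP lp.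
(* Only [Kn n] many points of the [n]th piece can have neighbourhoods of size at
   most [Kn n], by [low_le]. *)
pose C n := [set x | ~ (U x #<= [set: Kn n]) /\ exists k, x = h (pr (k, n))].
have KC n : [set: K] #<= C n.
  have : [set: K] #<= C n `|` [set x | U x #<= [set: Kn n]].
    apply: (@card_le_fun _ _ _ _ (fun k => h (pr (k, n)))) => [k _|k k' _ _ /hI /prI[]//].
    have [Uk|Uk] := pselect (U (h (pr (k, n))) #<= [set: Kn n]); first by right.
    by left; split => //; exists k.
  move=> /(infinite_le_setU Kinf)[//|/(low_le Kunc)].
  by move=> /(increasing_lt KnK).
have C_fun n : exists i : Kn n -> X, (forall z, C n (i z)) /\ injective i.
  exact: card_leT_funP (card_le_trans (Knl n) (KC n)).
pose i n := sval (cid (C_fun n)); have iP n := svalP (cid (C_fun n)).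
rewrite -/(i _) in iP.
exists gl, (fun s => i (projT1 s) (projT2 s)); split=> //.
- move=> [n z] [n' z'] /= e.
  have [_ [k kE]] := (iP n).1 z; have [_ [k' kE']] := (iP n').1 z'.
  have : h (pr (k, n)) = h (pr (k', n')) by rewrite -kE -kE'.
  move=> /hI /prI [_ nn']; subst n'; by rewrite ((iP n).2 _ _ e).
- move=> l [n z] /= e; have [_ [k kE]] := (iP n).1 z.
  have [/card_eqPle[_ KU] _] := glp l; apply: (hs (pr (k, n))).
  by have <- : gl l = h (pr (k, n)) by rewrite e; exact: kE.
- move=> [n z] /=; have [nU [k kE]] := (iP n).1 z; split=> // -[/card_eqPle[_ KU] _].
  by apply: (hs (pr (k, n))); rewrite -kE.
Qed.

(** A point with a small neighbourhood lies in a small basic set [b m], which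
    embeds into [Kn (k m)]; since [k] is injective, recording this index together
    with the image of the point loses nothing. *)
Lemma tsum_seq_at_cof_omega_uncountable : ~ countable [set: K] ->
  tukey_eq (tsum seq_family) (tsum (sum_family
    (sum_family (fun _ : lambda => relP K) (fun _ : mu => prod_infty Kn))
    (fun s : {n & Kn n} => relP (Kn (projT1 s))))).
Proof.
move=> Kunc; have [gl [gs [glp glI gsI gls gsP]]] := relS_points Kunc.
have [|k [kI bk]] := @eventually_injective
  (fun m n => ~ ([set: K] #<= b m) -> b m #<= [set: Kn n]).
  move=> m; have [Kb|Kb] := pselect ([set: K] #<= b m); first by exists 0%N.
  have [N NP] := increasing_small_le KnK Kb; exists N => n Nn _; exact: NP.
have /choice[m mP] x : exists m, ~ ([set: K] #<= U x) ->
    nbhs x (b m) /\ ~ ([set: K] #<= b m).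
  have [KU|/small_base[m mP]] := pselect ([set: K] #<= U x); first by exists 0%N.
  by exists m.
have bR n : exists Rel : X -> Kn (k n) -> Prop, ~ ([set: K] #<= b n) ->
    (forall x, b n x -> exists z, Rel x z) /\
    (forall x x' z, b n x -> b n x' -> Rel x z -> Rel x' z -> x = x').
  have [Kb|Kb] := pselect ([set: K] #<= b n); first by exists (fun _ _ => False).
  have [Rel [Rt RI]] := (card_le_relP _ _).1 (bk n Kb).
  by exists Rel => _; split=> // x /Rt[z]; exists z.
pose Rel n := sval (cid (bR n)); have RelP n := svalP (cid (bR n)).
rewrite -/(Rel _) in RelP.
apply: (@tsum_seq_at_cof_omega _ _ (fun x s => ~ ([set: K] #<= U x) /\
  exists2 z, Rel (m x) x z & s = existT Kn (k (m x)) z) gl gs) => //.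
- move=> s; have [smin sU] := gsP s.
  have sinh : inhabited (Kn (projT1 s)) by constructor; exact: projT2 s.
  have sacc : accumulation (gs s).
    apply: contrapT => /not_accumulation_U Us; apply: sU; apply: card_le_trans Us _.
    by apply: (@card_le_fun _ _ _ _ (fun=> projT2 s)) => // x y -> ->.
  split=> //; first exact: seq_at_ge_relP_lt.
  by apply: (@fin_seq_infty_inhabited _ 0%N).
- move=> x xacc nKU; have [bx nKb] := mP x nKU.
  have [z Rxz] := (RelP _ nKb).1 x (nbhs_singleton bx).
  exists (existT Kn (k (m x)) z); first by split => //; exists z.
  exact: (relP_ge_seq_at d_ge0 d_eq0 d_nbhs xacc bx (bk _ nKb)).
- move=> x x' s [nKU [z Rxz ->]] [nKU' [z' Rxz' e]].
  have [bx nKb] := mP x nKU; have [bx' _] := mP x' nKU'.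
  have mx : m x = m x' by apply: kI; exact: existT_inj1 e.
  move: z' Rxz' bx' e; rewrite -mx => z' Rxz' bx' e.
  have zz' := existT_injr e; rewrite -zz' in Rxz'.
  exact: ((RelP _ nKb).2 _ _ _ (nbhs_singleton bx) (nbhs_singleton bx') Rxz Rxz').
Qed.

End CofinalityOmega.

End Space.

(** * The decomposition *)

Theorem theorem4p10 (R : realType) (M : topologicalType)
  (hmet : metrizable R M) (hsep : separable M)
  (U : M -> set M) (hU : min_card_open_nbhs U)
  (kappa : Type) (hkappa : [set: kappa] #= [set: M])
  (kappan : nat -> Type)
  (hkappan : cof_omega kappa -> increasing_up_to kappan kappa)
  (lambda : Type) (hlambda : [set: lambda] #= M_card_plus U kappa)
  (mu : Type) (hmu : [set: mu] #= M_card_minus U kappa) :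
  tukey_eq (seq_rel M)
    (tadd (tadd (tprod (relP kappa) (teq lambda))
                (tprod (relQ kappa kappan) (teq mu)))
          (relS kappa kappan))
  /\ [set: lambda] #<= [set: kappa]
  /\ [set: mu] #<= [set: nat].
Proof.
have [d [d_ge0 d_eq0 d_sym d_tri d_nbhs]] := hmet.
have [b b_base] := separable_base d_eq0 d_sym d_tri d_nbhs hsep.
split; last first.
  rewrite (card_le_eql hlambda) (card_le_eql hmu).
  split; first exact: sub_K hkappa _.
  exact: (M_card_minus_countable d_ge0 d_eq0 d_sym d_tri d_nbhs b_base hU hkappa).
apply: tukey_eq_trans (seq_rel_tsum d_ge0 d_eq0 d_sym d_tri d_nbhs) _.
have Pl := tprod_teq_tsum (relP kappa) lambda.
pose E (v : void) : trel := match v with end.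
rewrite /relS /relQ; have [cof|ncof] := pselect (cof_omega kappa).
  rewrite (asboolT cof); have Qm := tprod_teq_tsum (prod_infty kappan) mu.
  have Kinf := cof_omega_infinite cof; have KnK := hkappan cof.
  have [Kcount|Kunc] := pselect (countable [set: kappa]).
    rewrite asboolF; last by case.
    apply: tukey_eq_trans (tukey_eq_sym (tadd_tsum (tadd_tsum Pl Qm) (tzero_tsum E))).
    exact: (tsum_seq_at_cof_omega_countable d_ge0 d_eq0 d_nbhs hU hkappa hlambda
      hmu KnK Kinf).
  rewrite asboolT//.
  apply: tukey_eq_trans (tukey_eq_sym (tadd_tsum (tadd_tsum Pl Qm)
    (tsum_tprod_teq_tsum (fun n => relP (kappan n)) kappan))).
  exact: (tsum_seq_at_cof_omega_uncountable d_ge0 d_eq0 d_sym d_tri d_nbhs b_base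
    hU hkappa hlambda hmu KnK Kinf Kunc).
rewrite (asboolF ncof) asboolF; last by case.
have P0 : tukey_eq (tprod (relP kappa) (teq lambda)) (tadd (tadd
    (tprod (relP kappa) (teq lambda)) (tprod tzero (teq mu))) tzero).
  apply: tukey_eq_trans (tukey_eq_sym (tadd_empty _ _ _)) => //.
  by apply: tukey_eq_sym; apply: tadd_empty => -[].
apply: tukey_eq_trans P0; apply: tukey_eq_trans (tukey_eq_sym Pl).
exact: (tsum_seq_at_not_cof_omega d_ge0 d_eq0 d_nbhs b_base hU hkappa hlambda ncof).
Qed.
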